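(* Let $n,m$ be coprime positive integers and let $\mathring{\mathfrak g}=\mathfrak{sl}(n|m)$. Then there is a $\mathfrak T_{iso}$-equivariant bijection $[X\times\mathbb Z]\to\mathcal B$ (for the actions $\mathbb F:\mathfrak T_{iso}\to\mathcal S([X\times\mathbb Z])$ and $\mathbf B:\mathfrak T_{iso}\to\mathcal S(\mathcal B)$) under which the class $[\emptyset,0]$ corresponds to $\mathfrak b$, the Borel subalgebra of $\widehat L(\mathring{\mathfrak g})$ which is the extension of the distinguished Borel subalgebra of $\mathring{\mathfrak g}$.
   Context: **Young diagrams.** $\mathbf R$ is a rectangle with $n$ rows, indexed from the top down by $\epsilon_1,\dots,\epsilon_n$, and $m$ columns, indexed from left to right by $\delta_1,\dots,\delta_m$. The box in row $\epsilon_i$ and column $\delta_j$ is denoted $\mathfrak B(\epsilon_i-\delta_j)$. $X$ is the set of partitions $\lambda=(\lambda_1\ge\dots\ge\lambda_n)$ with $m\ge\lambda_1$, $\lambda_n\ge0$, identified with Young diagrams in the bottom left corner of $\mathbf R$: $\lambda_p$ is the number of (leftmost) boxes of $\lambda$ in the $p$-th row from the bottom, i.e. row $\epsilon_{n+1-p}$. $\lambda'_j=|\{p:\lambda_p\ge j\}|$; $\emptyset=(0^n)$. Set $\Delta_1^+=\{\epsilon_i-\delta_j: 1\le i\le n,1\le j\le m\}$, $\Delta_{iso}=\Delta_1^+\cup(-\Delta_1^+)$. For $\alpha\in\Delta_1^+$, $X_\alpha$ is the set of $\lambda\in X$ such that $\mathfrak B(\alpha)\notin\lambda$ and adding $\mathfrak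 B(\alpha)$ to $\lambda$ gives a Young diagram; $X_{-\alpha}$ is the set of $\lambda\in X$ such that $\mathfrak B(\alpha)\in\lambda$ and deleting $\mathfrak B(\alpha)$ gives a Young diagram; $t_\alpha:X_\alpha\to X_{-\alpha}$ adds, and $t_{-\alpha}:X_{-\alpha}\to X_\alpha$ deletes, the box $\mathfrak B(\alpha)$. **Groupoid.** $\mathfrak T_{iso}$ is the groupoid with base $\Delta_{iso}$ and non-identity morphisms $\rho_\alpha:\alpha\to-\alpha$ ($\alpha\in\Delta_{iso}$). For a set $Y$, $\mathcal S(Y)$ is the groupoid whose objects are the subsets of $Y$ and whose morphisms are the bijections between subsets; an action on $Y$ is a functor to $\mathcal S(Y)$; orbits are the connected components of the graph with edges $y\to H(g)y$. Given actions $F$ on $Y$ and $B$ on $Z$, both transitive (one orbit), a bijection $\omega:Y\to Z$ is $\mathfrak T_{iso}$-equivariant if $B$ is the composite of $F$ with the isomorphism $\mathcal S(Y)\to\mathcal S(Z)$, $g\mapsto\omega g\omega^{-1}$, induced by $\omega$; thus $\omega(F(g)y)=B(g)\omega(y)$, one side being defined iff the other is. **Adding and deleting rows and columns.** $X(\mathrm{r.full})=\{\lambda_1=m\}$, $X(\mathrm{r.empty})=\{\lambda_n=0\}$, $X(\mathrm{c.full})=\{\lambda'_1=n\}$, $X(\mathrm{c.empty})=\{\lambda'_m=0\}$. Put $\lambda^{-_r}=(\lambda_2,\dots,\lambda_n,0)$ for $\lambda\in X(\mathrm{r.full})$; $\lambda^{+_r}=(m,\lambda_1,\dots,\lambda_{n-1})$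 for $\lambda\in X(\mathrm{r.empty})$; $\lambda^{-_c}=(\lambda_1-1,\dots,\lambda_n-1)$ for $\lambda\in X(\mathrm{c.full})$; $\lambda^{+_c}=(\lambda_1+1,\dots,\lambda_n+1)$ for $\lambda\in X(\mathrm{c.empty})$. $\sim$ is the smallest equivalence relation on $X\times\mathbb Z$ with $(\lambda,k)\sim(\lambda^{-_r},k+m)$ for $\lambda\in X(\mathrm{r.full})$ and $(\lambda,k)\sim(\lambda^{-_c},k+n)$ for $\lambda\in X(\mathrm{c.full})$. $[X\times\mathbb Z]$ is the set of classes $[\lambda,k]$. **Action $\mathbb F$.** $\nu,\eta$ act on roots by $\nu(\epsilon_i)=\epsilon_{i+1}$ (indices mod $n$), $\nu(\delta_j)=\delta_j$, $\eta(\delta_{j+1})=\delta_j$ (indices mod $m$), $\eta(\epsilon_i)=\epsilon_i$. Every integer is $k=in+jm$ with $i,j\in\mathbb Z$, and $\eta^i\nu^j$ depends only on $k$. $\mathbb F(\alpha)$ is the set of classes containing some $(\lambda,in+jm)$ with $\lambda\in X_{\eta^i\nu^j\alpha}$, and $\mathbb F(\rho_\alpha)[\lambda,in+jm]=[t_{\eta^i\nu^j\alpha}(\lambda),in+jm]$ for such $(\lambda,in+jm)$. **Words, shuffles and simple roots.** The word of $\lambda\in X$ is the sequence of $m$ letters $\mathtt r$ and $n$ letters $\mathtt d$ given by the right and down unit steps of the upper border of $\lambda$ from the top left to the bottom right corner of $\mathbf R$. The shuffle $\sigma$ of $\lambda$ is the sequence $(\sigma(1),\dots,\sigma(m+n))$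 obtained by replacing, from left to right, the letters $\mathtt d$ by $1,\dots,n$ and the letters $\mathtt r$ by $1',\dots,m'$. Put $\epsilon_{j'}=\delta_j$ and $r=m+n-1$. The Borel subalgebra $\mathring{\mathfrak b}(\lambda)=\mathring{\mathfrak b}(\sigma)$ of $\mathring{\mathfrak g}$ has ordered list of simple roots $\epsilon_{\sigma(p)}-\epsilon_{\sigma(p+1)}$, $1\le p\le r$, and its even part is upper triangular; $\mathring{\mathfrak b}(\emptyset)$ is the distinguished Borel subalgebra. **Affinization.** Over an algebraically closed field $\mathtt k$ of characteristic 0, $\widehat L(\mathring{\mathfrak g})=(\mathtt k[t,t^{-1}]\otimes\mathring{\mathfrak g})\oplus\mathtt kc\oplus\mathtt kd$ with $[t^a\otimes x,t^b\otimes y]=t^{a+b}\otimes[x,y]+a(x,y)\delta_{a,-b}c$ for an invariant bilinear form $(\,,\,)$, $c$ central, and $d$ acting as $t\frac{d}{dt}$ on the loop algebra. $\overline\delta$ is the basic imaginary root ($\overline\delta(d)=1$, $\overline\delta$ zero on $c$ and on diagonal matrices). Roots are written as integer combinations of the $\epsilon_i,\delta_j,\overline\delta$, and Borel subalgebras are described by their sets of simple roots. **The algebras $\mathring{\mathfrak g}(k)$ and Borels $\mathring{\mathfrak b}(\lambda,k)$.** For each $(\lambda,k)\in X\times\mathbb Z$ there is a Borel subalgebra $\mathring{\mathfrak b}(\lambda,k)$ of a subalgebra $\mathring{\mathfrak g}(k)\cong\mathring{\mathfrak g}$ of $\widehat L(\mathring{\mathfrak g})$, with ordered simple roots $(\beta_1,\dots,\beta_r)$,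 and extending root $\beta_0=\overline\delta-\sum_{p=1}^r\beta_p$; $\mathring{\mathfrak g}(k)$ is generated by the root spaces of the $\pm\beta_p$, $1\le p\le r$. They are determined by: $\mathring{\mathfrak g}(0)=\mathring{\mathfrak g}$ and $\mathring{\mathfrak b}(\lambda,0)=\mathring{\mathfrak b}(\lambda)$; if $\lambda\in X(\mathrm{r.full})$, then $\mathring{\mathfrak b}(\lambda^{-_r},k+m)$ has list $(\beta_0,\dots,\beta_{r-1})$; if $\lambda\in X(\mathrm{c.empty})$, then $\mathring{\mathfrak b}(\lambda^{+_c},k-n)$ has list $(\beta_0,\dots,\beta_{r-1})$; reversing these, $\mathring{\mathfrak b}(\lambda^{+_r},k-m)$ for $\lambda\in X(\mathrm{r.empty})$ and $\mathring{\mathfrak b}(\lambda^{-_c},k+n)$ for $\lambda\in X(\mathrm{c.full})$ have list $(\beta_2,\dots,\beta_r,\beta_0)$; and for fixed $k$ the Borels $\mathring{\mathfrak b}(\lambda,k)$ for different $\lambda$ are related by odd reflections: if $\lambda\in X_\alpha$ and $t_\alpha$ interchanges letters $p,p+1$ of the word, the list for $(t_\alpha(\lambda),k)$ is obtained by the odd reflection at $\beta_p$. The local name of $\beta_p$ ($1\le p\le r$) is $\epsilon_{\sigma(p)}-\epsilon_{\sigma(p+1)}$, $\sigma$ the shuffle of $\lambda$. The extension of $\mathring{\mathfrak b}(\lambda,k)$ to $\widehat L(\mathring{\mathfrak g})$ is the Borel subalgebra with simple roots $\{\beta_0,\dots,\beta_r\}$. The odd reflection at an odd isotropic simple root $\beta$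 replaces $\beta$ by $-\beta$, a simple root $\gamma\neq\beta$ by $\gamma+\beta$ if that is a root, and fixes the other simple roots. **$\mathcal B$ and the action $\mathbf B$.** $\mathcal B$ is the set of Borel subalgebras of $\widehat L(\mathring{\mathfrak g})$ that are extensions of the $\mathring{\mathfrak b}(\lambda,k)$, $(\lambda,k)\in X\times\mathbb Z$. $\mathfrak T_{iso}$ acts by odd reflections: $\mathbf B(\alpha)$ is the set of elements of $\mathcal B$ that are extensions of some $\mathring{\mathfrak b}(\lambda,in+jm)$ having a simple root with local name $\eta^i\nu^j\alpha$ (i.e. $\lambda\in X_{\eta^i\nu^j\alpha}$), and $\mathbf B(\rho_\alpha)$ performs the odd reflection at that simple root, giving the extension of $\mathring{\mathfrak b}(t_{\eta^i\nu^j\alpha}(\lambda),in+jm)$. *)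

(* Defs.v *)
From HB Require Import structures.
From mathcomp Require Import all_boot all_order all_algebra.
From mathcomp Require Import boolp classical_sets functions cardinality fsbigop.
From Stdlib Require Import Relations.Relation_Operators.

Set Implicit Arguments.
Unset Strict Implicit.
Unset Printing Implicit Defensive.

Import GRing.Theory.
Local Open Scope classical_set_scope.
Local Open Scope ring_scope.

(** * Groupoids and actions *)

Record groupoid := Groupoid {
  gob : Type;
  ghom : gob -> gob -> Type;
  gid : forall a, ghom a a;
  gcomp : forall a b c, ghom b c -> ghom a b -> ghom a c;
  ginv : forall a b, ghom a b -> ghom b a;
  gcompA : forall a b c d (h : ghom c d) (g : ghom b c) (f : ghom a b),
    gcomp h (gcomp g f) = gcomp (gcomp h g) f;
  gcomp1l : forall a b (f : ghom a b), gcomp (gid b) f = f;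
  gcomp1r : forall a b (f : ghom a b), gcomp f (gid a) = f;
  ginvl : forall a b (f : ghom a b), gcomp (ginv f) f = gid a;
  ginvr : forall a b (f : ghom a b), gcomp f (ginv f) = gid b }.

Record gfunctor (C D : groupoid) := GFunctor {
  fob : gob C -> gob D;
  fmor : forall a b, ghom a b -> ghom (fob a) (fob b);
  fmor_id : forall a, fmor (gid a) = gid (fob a);
  fmor_comp : forall a b c (g : ghom b c) (f : ghom a b),
    fmor (gcomp g f) = gcomp (fmor g) (fmor f) }.

(* A bijection between the subsets A and B of Y, given by its graph. *)
Definition bij_graph (Y : Type) (A B : set Y) (R : Y -> Y -> Prop) : Prop :=
  [/\ forall y z, R y z -> A y /\ B z,
      forall y, A y -> exists! z, R y z &
      forall z, B z -> exists! y, R y z].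

Record sbij (Y : Type) (A B : set Y) := SBij {
  sgraph : Y -> Y -> Prop;
  sgraphP : bij_graph A B sgraph }.

Lemma sbij_inj Y (A B : set Y) (f g : sbij A B) :
  (forall y z, sgraph f y z <-> sgraph g y z) -> f = g.
Proof.
case: f g => [R RP] [S SP] /= E.
have {}E : R = S by apply/funext => y; apply/funext => z; apply/propext.
by subst S; congr SBij; exact: Prop_irrelevance.
Qed.

Lemma sbij_id_subproof Y (A : set Y) : bij_graph A A (fun y z => A y /\ z = y).
Proof.
split=> [y z [Ay ->] // | y Ay | y Ay]; exists y; split=> // z; first by case.
by case=> _ ->.
Qed.
Definition sbij_id Y (A : set Y) : sbij A A := SBij (sbij_id_subproof A).

Lemma sbij_comp_subproof Y (A B C : set Y) (g : sbij B C) (f : sbij A B) :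
  bij_graph A C (fun x z => exists2 y, sgraph f x y & sgraph g y z).
Proof.
case: f g => [R [R1 R2 R3]] [S [S1 S2 S3]] /=; split.
- by move=> x z [y /R1[Ax _] /S1[_ Cz]].
- move=> x Ax; have [y [xy yu]] := R2 _ Ax.
  have [z [yz zu]] := S2 _ (R1 _ _ xy).2.
  by exists z; split; [exists y | move=> z' [y' /yu <- /zu]].
- move=> z Cz; have [y [yz yu]] := S3 _ Cz.
  have [x [xy xu]] := R3 _ (S1 _ _ yz).1.
  by exists x; split; [exists y | move=> x' [y' xy' /yu yy']; apply: xu; rewrite yy'].
Qed.
Definition sbij_comp Y (A B C : set Y) (g : sbij B C) (f : sbij A B) : sbij A C :=
  SBij (sbij_comp_subproof g f).

Lemma sbij_inv_subproof Y (A B : set Y) (f : sbij A B) :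
  bij_graph B A (fun y x => sgraph f x y).
Proof. by case: f => [R [R1 R2 R3]] /=; split=> // y z /R1[]. Qed.
Definition sbij_inv Y (A B : set Y) (f : sbij A B) : sbij B A :=
  SBij (sbij_inv_subproof f).

Lemma sbij_compA Y (A B C D : set Y) (h : sbij C D) (g : sbij B C) (f : sbij A B) :
  sbij_comp h (sbij_comp g f) = sbij_comp (sbij_comp h g) f.
Proof.
apply: sbij_inj => x t /=; split.
  by case=> z [y xy yz] zt; exists y => //; exists z.
by case=> y xy [z yz zt]; exists z => //; exists y.
Qed.

Lemma sbij_comp1l Y (A B : set Y) (f : sbij A B) : sbij_comp (sbij_id B) f = f.
Proof.
apply: sbij_inj => x y /=; split=> [[z xz [_ ->]] // | xy].
by exists y => //; split=> //; case: (sgraphP f) => /(_ _ _ xy)[].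
Qed.

Lemma sbij_comp1r Y (A B : set Y) (f : sbij A B) : sbij_comp f (sbij_id A) = f.
Proof.
apply: sbij_inj => x y /=; split=> [[z [_ ->]] // | xy].
by exists x => //; split=> //; case: (sgraphP f) => /(_ _ _ xy)[].
Qed.

Lemma sbij_invl Y (A B : set Y) (f : sbij A B) :
  sbij_comp (sbij_inv f) f = sbij_id A.
Proof.
apply: sbij_inj => x z /=; case: (sgraphP f) => R1 R2 R3; split.
- case=> y xy zy; split; first by case: (R1 _ _ xy).
  by have [w [_ wu]] := R3 _ (R1 _ _ xy).2; rewrite -(wu _ xy) (wu _ zy).
- by case=> Ax ->; have [y [xy _]] := R2 _ Ax; exists y.
Qed.

Lemma sbij_invr Y (A B : set Y) (f : sbij A B) :
  sbij_comp f (sbij_inv f) = sbij_id B.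
Proof.
apply: sbij_inj => x z /=; case: (sgraphP f) => R1 R2 R3; split.
- case=> y yx yz; split; first by case: (R1 _ _ yx).
  by have [w [_ wu]] := R2 _ (R1 _ _ yx).1; rewrite -(wu _ yx) (wu _ yz).
- by case=> Bx ->; have [y [yx _]] := R3 _ Bx; exists y.
Qed.

(* The groupoid S(Y). *)
Definition subset_groupoid (Y : Type) : groupoid :=
  @Groupoid (set Y) (@sbij Y) (@sbij_id Y) (@sbij_comp Y) (@sbij_inv Y)
    (@sbij_compA Y) (@sbij_comp1l Y) (@sbij_comp1r Y)
    (@sbij_invl Y) (@sbij_invr Y).

Definition action (G : groupoid) (Y : Type) := gfunctor G (subset_groupoid Y).

Definition act_obj G Y (H : action G Y) (a : gob G) : set Y := fob H a.

Definition act_mor G Y (H : action G Y) (a b : gob G) (g : ghom a b) :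
  Y -> Y -> Prop := @sgraph Y (fob H a) (fob H b) (fmor H g).

Definition act_edge G Y (H : action G Y) (y z : Y) : Prop :=
  exists (a b : gob G) (g : ghom a b), act_mor H g y z.

Definition act_transitive G Y (H : action G Y) : Prop :=
  exists y, forall z, clos_refl_sym_trans Y (act_edge H) y z.

(* B is the composite of F with the isomorphism S(Y) -> S(Z) induced by w. *)
Definition equivariant G Y Z (F : action G Y) (B : action G Z) (w : Y -> Z) :
  Prop :=
  [/\ act_transitive F, act_transitive B, bijective w,
      forall a, act_obj B a = w @` act_obj F a &
      forall a b (g : ghom a b) y z,
        act_mor F g y z <-> act_mor B g (w y) (w z)].

(** * The groupoid T_iso *)

(* (false, (i, j)) is eps_(i+1) - del_(j+1), (true, (i, j)) is its opposite. *)
Definition iso_root (n m : nat) : Type := (bool * ('I_n * 'I_m))%type.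

Definition iso_opp n m (a : iso_root n m) : iso_root n m := (~~ a.1, a.2).

(* true stands for rho_a : a -> - a, false for the identity. *)
Definition tiso_hom n m (a b : iso_root n m) : Type :=
  {s : bool | b == (if s then iso_opp a else a)}.

Definition tiso_id n m (a : iso_root n m) : tiso_hom a a :=
  exist _ false (eqxx a).

Definition rho n m (a : iso_root n m) : tiso_hom a (iso_opp a) :=
  exist _ true (eqxx (iso_opp a)).

Lemma tiso_comp_subproof n m (a b c : iso_root n m)
    (g : tiso_hom b c) (f : tiso_hom a b) :
  c == if val g (+) val f then iso_opp a else a.
Proof.
case: g f => s /= /eqP cE [t /= /eqP bE]; rewrite cE bE.
by case: s t a {cE bE} => [] [] [e x]; rewrite /iso_opp /= ?negbK.
Qed.
Definition tiso_comp n m (a b c : iso_root n m)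
    (g : tiso_hom b c) (f : tiso_hom a b) : tiso_hom a c :=
  exist (fun s : bool => c == (if s then iso_opp a else a)) _
    (tiso_comp_subproof g f).

Lemma tiso_inv_subproof n m (a b : iso_root n m) (f : tiso_hom a b) :
  a == if val f then iso_opp b else b.
Proof.
case: f => s /= /eqP bE; rewrite bE.
by case: s a {bE} => [] [e x]; rewrite /iso_opp /= ?negbK.
Qed.
Definition tiso_inv n m (a b : iso_root n m) (f : tiso_hom a b) : tiso_hom b a :=
  exist (fun s : bool => a == (if s then iso_opp b else b)) _
    (tiso_inv_subproof f).

Lemma tiso_compA n m (a b c d : iso_root n m)
    (h : tiso_hom c d) (g : tiso_hom b c) (f : tiso_hom a b) :
  tiso_comp h (tiso_comp g f) = tiso_comp (tiso_comp h g) f.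
Proof. by apply: val_inj; rewrite /= addbA. Qed.

Lemma tiso_comp1l n m (a b : iso_root n m) (f : tiso_hom a b) :
  tiso_comp (tiso_id b) f = f.
Proof. exact: val_inj. Qed.

Lemma tiso_comp1r n m (a b : iso_root n m) (f : tiso_hom a b) :
  tiso_comp f (tiso_id a) = f.
Proof. by apply: val_inj; rewrite /= addbF. Qed.

Lemma tiso_invl n m (a b : iso_root n m) (f : tiso_hom a b) :
  tiso_comp (tiso_inv f) f = tiso_id a.
Proof. by apply: val_inj; rewrite /= addbb. Qed.

Lemma tiso_invr n m (a b : iso_root n m) (f : tiso_hom a b) :
  tiso_comp f (tiso_inv f) = tiso_id b.
Proof. by apply: val_inj; rewrite /= addbb. Qed.

Definition tiso (n m : nat) : groupoid :=
  @Groupoid (iso_root n m) (@tiso_hom n m) (@tiso_id n m) (@tiso_comp n m)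
    (@tiso_inv n m) (@tiso_compA n m) (@tiso_comp1l n m) (@tiso_comp1r n m)
    (@tiso_invl n m) (@tiso_invr n m).

(** * Young diagrams *)

(* The entries of parts are lambda_1 >= ... >= lambda_n, i.e. the rows of the
   diagram read from the bottom of the rectangle to its top. *)
Record young (n m : nat) := Young {
  parts :> n.-tuple nat;
  _ : sorted geq parts && all (fun a => a <= m)%N parts }.

HB.instance Definition _ n m := [isSub for @parts n m].
HB.instance Definition _ n m := [Choice of young n m by <:].

Lemma young0_subproof n m :
  sorted geq (nseq_tuple n 0%N) && all (fun a => a <= m)%N (nseq_tuple n 0%N).
Proof.
rewrite /= all_nseq orbT andbT; case: n => //= n.
by elim: n => //= n ->; rewrite andbT.
Qed.
Definition young0 n m : young n m := Young (young0_subproof n m).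

(* The box in row eps_(i+1) (from the top) and column del_(j+1). *)
Definition diagram n m (lam : young n m) : set ('I_n * 'I_m) :=
  [set x : 'I_n * 'I_m | (x.2 < nth 0 lam (rev_ord x.1))%N].

(* The graph of t_a : X_a -> X_(-a). *)
Definition tbox n m (a : iso_root n m) (lam mu : young n m) : Prop :=
  if a.1 then diagram lam a.2 /\ diagram mu = diagram lam `\ a.2
  else ~ diagram lam a.2 /\ diagram mu = diagram lam `|` [set a.2].

Definition Xiso n m (a : iso_root n m) : set (young n m) :=
  [set lam | exists mu, tbox a lam mu].

Definition conj_part n m (lam : young n m) (j : nat) : nat :=
  count (fun a => j <= a)%N lam.

Definition r_full n m (lam : young n m) : bool := nth 0%N lam 0 == m.
Definition r_empty n m (lam : young n m) : bool := nth 0%N lam n.-1 == 0%N.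
Definition c_full n m (lam : young n m) : bool := conj_part lam 1 == n.
Definition c_empty n m (lam : young n m) : bool := conj_part lam m == 0%N.

(* The graphs of the four partial maps lam |-> lam^(-r), lam^(+r), lam^(-c),
   lam^(+c). *)
Definition del_row n m (lam mu : young n m) : Prop :=
  r_full lam /\ mu = rcons (behead lam) 0%N :> seq nat.
Definition add_row n m (lam mu : young n m) : Prop :=
  r_empty lam /\ mu = m :: take n.-1 lam :> seq nat.
Definition del_col n m (lam mu : young n m) : Prop :=
  c_full lam /\ mu = map predn lam :> seq nat.
Definition add_col n m (lam mu : young n m) : Prop :=
  c_empty lam /\ mu = map succn lam :> seq nat.

(** * The classes [lambda, k] and the action F *)

Inductive class_step n m : young n m * int -> young n m * int -> Prop :=
| class_step_r lam mu (k : int) :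
    del_row lam mu -> class_step (lam, k) (mu, k + m%:Z)
| class_step_c lam mu (k : int) :
    del_col lam mu -> class_step (lam, k) (mu, k + n%:Z).

Definition class_set n m (x : young n m * int) : set (young n m * int) :=
  [set y | clos_refl_sym_trans _ (@class_step n m) x y].

Definition classes (n m : nat) : Type :=
  {C : set (young n m * int) | exists x, C = class_set x}.

Definition mkclass n m (lam : young n m) (k : int) : classes n m :=
  exist _ (class_set (lam, k)) (ex_intro _ (lam, k) erefl).

Definition iterz (T : Type) (f finv : T -> T) (k : int) (x : T) : T :=
  match k with
  | Posz p => iter p f x
  | Negz p => iter p.+1 finv x
  end.

(* eta^i nu^j, where nu (eps_a) = eps_(a+1) and eta (del_(b+1)) = del_b,
   cyclically. *)
Definition rotate n m (i j : int) (a : iso_root n m) : iso_root n m :=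
  (a.1, (iterz (@ordS n) (@ord_pred n) j a.2.1,
         iterz (@ord_pred m) (@ordS m) i a.2.2)).

Definition lincomb (n m : nat) (i j : int) : int := i * n%:Z + j * m%:Z.

Definition is_actionF n m (F : action (tiso n m) (classes n m)) : Prop :=
  (forall (a : iso_root n m) y,
     act_obj F a y <->
     exists lam i j, Xiso (rotate i j a) lam /\
       y = mkclass lam (lincomb n m i j)) /\
  (forall (a : iso_root n m) y z,
     act_mor F (rho a : @ghom (tiso n m) a (iso_opp a)) y z <->
     exists lam mu i j,
       [/\ tbox (rotate i j a) lam mu,
           y = mkclass lam (lincomb n m i j) &
           z = mkclass mu (lincomb n m i j)]).

(** * The affinization of sl(n|m) *)

(* (f, x, y) stands for the sum of the t^a (x) f a, plus x c + y d; only the f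
   of finite support belong to the loop algebra. *)
Definition affine (k : fieldType) (n m : nat) : lmodType k :=
  ((int -> 'M[k]_(n + m)) * k^o * k^o)%type.

Definition mx_even (k : fieldType) n m (x : 'M[k]_(n + m)) : 'M[k]_(n + m) :=
  block_mx (ulsubmx x) 0 0 (drsubmx x).
Definition mx_odd (k : fieldType) n m (x : 'M[k]_(n + m)) : 'M[k]_(n + m) :=
  block_mx 0 (ursubmx x) (dlsubmx x) 0.

(* Bilinear extension of [x, y] = x y - (-1)^(|x||y|) y x. *)
Definition super_bracket (k : fieldType) n m (x y : 'M[k]_(n + m)) :
  'M[k]_(n + m) :=
  x *m y - (mx_even y *m x + mx_odd y *m mx_even x - mx_odd y *m mx_odd x).

Definition super_trace (k : fieldType) n m (x : 'M[k]_(n + m)) : k :=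
  \tr (ulsubmx x) - \tr (drsubmx x).

Definition invariant_form (k : fieldType) n m
    (frm : 'M[k]_(n + m) -> 'M[k]_(n + m) -> k) : Prop :=
  [/\ forall (a : k) x y z, frm (a *: x + y) z = a * frm x z + frm y z,
      forall (a : k) x y z, frm x (a *: y + z) = a * frm x y + frm x z &
      forall x y z,
        super_trace x = 0 -> super_trace y = 0 -> super_trace z = 0 ->
        frm (super_bracket x y) z = frm x (super_bracket y z)].

Definition affine_bracket (k : fieldType) n m
    (frm : 'M[k]_(n + m) -> 'M[k]_(n + m) -> k) (x y : affine k n m) :
  affine k n m :=
  ((fun s : int =>
      \sum_(a \in [set: int]) super_bracket (x.1.1 a) (y.1.1 (s - a))
      + (x.2 * s%:~R) *: y.1.1 s - (y.2 * s%:~R) *: x.1.1 s),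
   \sum_(a \in [set: int]) a%:~R * frm (x.1.1 a) (y.1.1 (- a)),
   0).

Definition affine_sl (k : fieldType) n m : set (affine k n m) :=
  [set x | finite_set [set a | x.1.1 a != 0] /\
           forall a, super_trace (x.1.1 a) = 0].

(* Diagonal matrices of gl(n|m) in degree 0, together with c and d. *)
Definition torus (k : fieldType) n m : set (affine k n m) :=
  [set x | (forall a, a != 0 -> x.1.1 a = 0) /\ is_diag_mx (x.1.1 0)].

Definition cartan (k : fieldType) n m : set (affine k n m) :=
  @affine_sl k n m `&` @torus k n m.

(* Integer combinations of eps_1, ..., eps_n, del_1, ..., del_m (first
   component) and of the basic imaginary root (second component). *)
Definition weights (n m : nat) : zmodType := ('rV[int]_(n + m) * int)%type.

Definition weight_eval (k : fieldType) n m (al : weights n m)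
    (h : affine k n m) : k :=
  \sum_(i < n + m) (al.1 0 i)%:~R * h.1.1 0 i i + (al.2)%:~R * h.2.

(* Weights are taken with respect to the diagonal matrices of gl(n|m), on which
   the eps_i and del_j are independent; on the traceless ones the root
   eps_1 - del_1 of sl(1|1) would vanish. *)
Definition root_space (k : fieldType) n m
    (frm : 'M[k]_(n + m) -> 'M[k]_(n + m) -> k) (al : weights n m) :
  set (affine k n m) :=
  [set x | affine_sl x /\
     forall h, torus h -> affine_bracket frm h x = weight_eval al h *: x].

Definition is_root (k : fieldType) n m
    (frm : 'M[k]_(n + m) -> 'M[k]_(n + m) -> k) (al : weights n m) : Prop :=
  al <> 0 /\ exists2 x, root_space frm al x & x <> 0.

Definition is_positive (k : fieldType) n m
    (frm : 'M[k]_(n + m) -> 'M[k]_(n + m) -> k) (base : seq (weights n m))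
    (al : weights n m) : Prop :=
  is_root frm al /\
  exists c : nat -> nat, al = \sum_(p < size base) base`_p *+ c p.

Definition is_subspace (k : fieldType) (V : lmodType k) (W : set V) : Prop :=
  W 0 /\ forall (a : k) x y, W x -> W y -> W (a *: x + y).

(* The Borel subalgebra with the given set of simple roots: the sum of the
   Cartan subalgebra and of the positive root spaces. *)
Definition borel (k : fieldType) n m
    (frm : 'M[k]_(n + m) -> 'M[k]_(n + m) -> k) (base : seq (weights n m)) :
  set (affine k n m) :=
  smallest (@is_subspace k (affine k n m))
    (@cartan k n m `|`
     \bigcup_(al in [set al | is_positive frm base al]) root_space frm al).

(** * Words, shuffles and simple roots *)

Inductive letter := Lr | Ld.
Definition is_r (x : letter) : bool := if x is Lr then true else false.
Definition is_d (x : letter) : bool := ~~ is_r x.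

(* The border of the rows s (from top to bottom), starting in abscissa c. *)
Fixpoint border (m c : nat) (s : seq nat) : seq letter :=
  if s is x :: s' then nseq (x - c) Lr ++ Ld :: border m x s'
  else nseq (m - c) Lr.

Definition word n m (lam : young n m) : seq letter := border m 0 (rev lam).

(* 0-based entries: the letter i+1 is encoded as i, and (j+1)' as n + j. *)
Definition shuffle n m (lam : young n m) : seq nat :=
  [seq (let u := take p (word lam) in
        if is_r (nth Lr (word lam) p) then (n + count is_r u)%N
        else count is_d u)
  | p <- iota 0 (n + m)].

(* eps_(x+1) for x < n and del_(x-n+1) for n <= x < n + m. *)
Definition evec n m (x : nat) : weights n m :=
  (\row_(i < n + m) ((i : nat) == x)%:Z, 0).

Definition iso_weight n m (a : iso_root n m) : weights n m :=
  let w := evec n m a.2.1 - evec n m (n + a.2.2) in if a.1 then - w else w.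

(* The simple roots of b(lambda), i.e. the local names of those of
   b(lambda, k). *)
Definition local_roots n m (lam : young n m) : seq (weights n m) :=
  [seq evec n m (nth 0%N (shuffle lam) p) - evec n m (nth 0%N (shuffle lam) p.+1)
  | p <- iota 0 (n + m).-1].

Definition imag_root n m : weights n m := (0, 1).

(* beta_0, given beta_1, ..., beta_r *)
Definition ext_root n m (base : seq (weights n m)) : weights n m :=
  imag_root n m - \sum_(b <- base) b.

Definition odd_reflection (k : fieldType) n m
    (frm : 'M[k]_(n + m) -> 'M[k]_(n + m) -> k) (p : nat)
    (base : seq (weights n m)) : seq (weights n m) :=
  mkseq (fun q => if q == p then - base`_p
                  else if `[< is_root frm (base`_q + base`_p) >]
                       then base`_q + base`_p else base`_q)
        (size base).

(* simple_roots frm lam j base: the ordered list of simple roots of b(lam, j)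
   is base. *)
Inductive simple_roots (k : fieldType) n m
    (frm : 'M[k]_(n + m) -> 'M[k]_(n + m) -> k) :
  young n m -> int -> seq (weights n m) -> Prop :=
| simple_roots0 lam : simple_roots frm lam 0 (local_roots lam)
| simple_roots_del_row lam mu (j : int) base :
    simple_roots frm lam j base -> del_row lam mu ->
    simple_roots frm mu (j + m%:Z) (take (size base) (ext_root base :: base))
| simple_roots_add_col lam mu (j : int) base :
    simple_roots frm lam j base -> add_col lam mu ->
    simple_roots frm mu (j - n%:Z) (take (size base) (ext_root base :: base))
| simple_roots_add_row lam mu (j : int) base :
    simple_roots frm lam j base -> add_row lam mu ->
    simple_roots frm mu (j - m%:Z) (rcons (behead base) (ext_root base))
| simple_roots_del_col lam mu (j : int) base :
    simple_roots frm lam j base -> del_col lam mu ->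
    simple_roots frm mu (j + n%:Z) (rcons (behead base) (ext_root base))
| simple_roots_reflection lam mu (j : int) base (a : iso_root n m) u x y v :
    simple_roots frm lam j base -> tbox a lam mu ->
    word lam = u ++ [:: x, y & v] -> word mu = u ++ [:: y, x & v] ->
    simple_roots frm mu j (odd_reflection frm (size u) base).

(* The extension to the affinization. *)
Definition ext_borel (k : fieldType) n m
    (frm : 'M[k]_(n + m) -> 'M[k]_(n + m) -> k) (base : seq (weights n m)) :
  set (affine k n m) := borel frm (ext_root base :: base).

(** * The set of Borel subalgebras and the action B *)

Definition borels (k : fieldType) n m
    (frm : 'M[k]_(n + m) -> 'M[k]_(n + m) -> k) : Type :=
  {b : set (affine k n m) |
    exists lam j base, simple_roots frm lam j base /\ b = ext_borel frm base}.

(* The extension of b(lam, i n + j m) is determined by its finite list base of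
   simple roots; the odd reflection takes place at base`_p, whose local name is
   eta^i nu^j a. *)
Definition is_actionB (k : fieldType) n m
    (frm : 'M[k]_(n + m) -> 'M[k]_(n + m) -> k)
    (B : action (tiso n m) (borels frm)) : Prop :=
  (forall (a : iso_root n m) b,
     act_obj B a b <->
     exists lam i j base,
       [/\ simple_roots frm lam (lincomb n m i j) base,
           iso_weight (rotate i j a) \in local_roots lam &
           sval b = ext_borel frm base]) /\
  (forall (a : iso_root n m) b b',
     act_mor B (rho a : @ghom (tiso n m) a (iso_opp a)) b b' <->
     exists lam mu i j base p,
       [/\ simple_roots frm lam (lincomb n m i j) base,
           (p < size (local_roots lam))%N /\
             (local_roots lam)`_p = iso_weight (rotate i j a),
           sval b = ext_borel frm base,
           sval b' = ext_borel frm (odd_reflection frm p base) &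
           tbox (rotate i j a) lam mu /\
             simple_roots frm mu (lincomb n m i j) (odd_reflection frm p base)]).

(* Main.v *)
Require Import Defs.
From mathcomp Require Import all_boot all_order all_algebra.
From mathcomp Require Import boolp classical_sets cardinality fsbigop.
From mathcomp Require Import zify ring.
From Stdlib Require Import Relations.Relation_Operators.

(** Continue the border of [lam], placed with its top left corner at row [- j]
    and column [i], periodically in the plane. Writing [k = i n + j m], which
    determines [(i, j)] up to multiples of [(m, - n)] because [n] and [m] are
    coprime, the pair [(lam, k)] becomes a window of length [n + m] on a
    bi-infinite periodic lattice path. Deleting a row or column only moves the
    window along the path, so the classes [[lam, k]] are the periodic paths; they
    are encoded by the profile sending a row to the abscissa of its down step.
    Labelling the down steps by [eps_x] and the right steps by [del_y], where one
    period subtracts the imaginary root, the simple roots of [b(lam, k)] are the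
    differences of consecutive labels in the window, and those of its extension
    are the differences along one period of the path. The root [eps_x - del_y] is
    positive exactly when the down step precedes the right step, that is, when
    the profile at [x] is at most [y]. As a Borel subalgebra contains the root
    vector of a real root only if this root is positive, it determines the
    profile, hence the class. Adding a box changes the profile by 1 on one
    residue class mod [n], so both actions are well defined. *)

Set Implicit Arguments.
Unset Strict Implicit.
Unset Printing Implicit Defensive.

Import Order.TTheory GRing.Theory Num.Theory.
Local Open Scope ring_scope.

(** * Words and Young diagrams *)

(* The inverse of [border]. *)
Fixpoint rows (c : nat) (w : seq letter) : seq nat :=
  match w with
  | [::] => [::]
  | Lr :: w' => rows c.+1 w'
  | Ld :: w' => c :: rows c w'
  end.

(** The prefix [u] acts on the rest of the walk only by moving its abscissa. *)
Lemma rows_cat c u w : rows c (u ++ w) = rows c u ++ rows (c + count is_r u) w.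
Proof.
by elim: u c => [|[] u IH] c /=; rewrite ?addn0 // IH ?add0n // addSn add1n addnS.
Qed.

Lemma size_rows c w : size (rows c w) = count is_d w.
Proof. by elim: w c => //= -[] w IH c /=; rewrite IH. Qed.

Lemma rows_path c w : path leq c (rows c w).
Proof.
elim: w c => //= -[] w IH c /=; last by rewrite leqnn IH.
by have := IH c.+1; case: (rows _ _) => //= x s /andP[/ltnW -> ->].
Qed.

Lemma rows_le c w : all (leq^~ (c + count is_r w)%N) (rows c w).
Proof.
elim: w c => //= -[] w IH c /=; first by rewrite add1n addnS -addSn.
by rewrite add0n leq_addr IH.
Qed.

Lemma border_r m c s : (c < m)%N -> all (leq c.+1) s ->
  border m c s = Lr :: border m c.+1 s.
Proof.
by case: s => [|x s] /= cm; [move=> _|case/andP=> cx _]; rewrite -subnSK.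
Qed.

Lemma border_rows c w : border (c + count is_r w) c (rows c w) = w.
Proof.
elim: w c => [|[] w IH] c /=; first by rewrite addn0 subnn.
  rewrite add1n addnS border_r ?ltnS ?leq_addr // -?addSn ?IH //.
  exact: order_path_min leq_trans (rows_path _ _).
by rewrite subnn add0n IH.
Qed.

Lemma rows_nseq c t w : rows c (nseq t Lr ++ w) = rows (c + t) w.
Proof. by elim: t c => [|t IH] c /=; rewrite ?addn0 // IH addSnnS. Qed.

Lemma rows_border m c s : path leq c s -> rows c (border m c s) = s.
Proof.
elim: s c => [|x s IH] c /=; first by rewrite -[nseq _ _]cats0 rows_nseq.
by case/andP=> cx xs; rewrite rows_nseq /= subnKC // IH.
Qed.

Lemma count_border_d m c s : count is_d (border m c s) = size s.
Proof.
elim: s c => [|x s IH] c /=; first by rewrite count_nseq.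
by rewrite count_cat count_nseq /= IH.
Qed.

Lemma count_border_r m c s : path leq c s -> all (leq^~ m) s ->
  count is_r (border m c s) = (m - c)%N.
Proof.
elim: s c => [|x s IH] c /=; first by rewrite count_nseq mul1n.
case/andP=> cx xs /andP[xm sm]; rewrite count_cat count_nseq /= IH // mul1n.
lia.
Qed.

Section Young.
Variables n m : nat.
Implicit Types (lam mu : young n m) (w u v : seq letter).

(** [border] reads the rows from top to bottom, while [parts] lists them from the bottom up;
    reversed, they increase weakly. *)
Lemma rev_young lam :
  [/\ size (rev lam) = n, path leq 0 (rev lam) & all (leq^~ m) (rev lam)].
Proof.
case: lam => t /= /andP[ts tm]; split; first by rewrite size_rev size_tuple.
  by rewrite path_min_sorted ?rev_sorted //; apply/allP.
by rewrite all_rev.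
Qed.

Lemma young_ex (s : seq nat) : size s = n -> sorted leq s -> all (leq^~ m) s ->
  exists lam : young n m, rev lam = s.
Proof.
move=> sn ss sm; have rn : size (rev s) == n by rewrite size_rev sn.
have H : sorted geq (Tuple rn) && all (fun a => a <= m)%N (Tuple rn).
  by rewrite /= all_rev sm andbT rev_sorted.
by exists (Young H); rewrite /= revK.
Qed.

Lemma young_inj lam mu : rev lam = rev mu -> lam = mu.
Proof. by move=> /(can_inj revK) E; apply/val_inj/val_inj. Qed.

Lemma rows_word lam : rows 0 (word lam) = rev lam.
Proof. by case: (rev_young lam) => _ H _; rewrite rows_border. Qed.

Lemma count_word_d lam : count is_d (word lam) = n.
Proof. by case: (rev_young lam) => H _ _; rewrite count_border_d. Qed.

Lemma count_word_r lam : count is_r (word lam) = m.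
Proof. by case: (rev_young lam) => _ H K; rewrite count_border_r // subn0. Qed.

Lemma size_word lam : size (word lam) = (n + m)%N.
Proof.
rewrite -(count_predC is_d) count_word_d -[in RHS](count_word_r lam).
by congr addn; apply: eq_count => -[].
Qed.

Lemma word_inj lam mu : word lam = word mu -> lam = mu.
Proof. by move=> E; apply: young_inj; rewrite -!rows_word E. Qed.

Lemma word_ex w : count is_d w = n -> count is_r w = m ->
  exists lam : young n m, word lam = w.
Proof.
move=> wd wr; have [|||lam E] := @young_ex (rows 0 w).
- by rewrite size_rows.
- exact: path_sorted (rows_path 0 w).
- by rewrite -wr; apply: rows_le.
by exists lam; have := border_rows 0 w; rewrite add0n wr /word E.
Qed.

(** The border of a diagram with full bottom row ends with the down step of that row. Deletion
    lowers the other rows and puts an empty row on top, so this step moves to the front. *)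
Lemma del_row_word lam mu : (0 < n)%N ->
  del_row lam mu <->
  exists v, word lam = rcons v Ld /\ word mu = Ld :: v.
Proof.
move=> n0.
have back (l l' : young n m) v : word l = rcons v Ld -> word l' = Ld :: v -> del_row l l'.
  move=> wl wl'; have := count_word_r l; rewrite wl -cats1 count_cat /= !addn0 => vr.
  have := rows_word l; rewrite wl -cats1 rows_cat vr cats1 /=.
  move/(congr1 rev); rewrite revK rev_rcons => El.
  have := rows_word l'; rewrite wl' /= => /(congr1 rev); rewrite revK rev_cons => El'.
  by split; [rewrite /r_full -El|rewrite -El -El'].
split; last by case=> v [wl wl']; apply: back wl wl'.
case=> /eqP full muE.
(* If the last letter were [Lr], at most [m - 1] right steps would precede the last down step, whose
   abscissa is [m]. *)
have [v wl] : exists v, word lam = rcons v Ld.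
  move: full; rewrite -[X in nth _ X]revK;
  case/lastP: (rev lam) (rows_word lam) (count_word_r lam) (size_rows 0 (word lam)).
    by rewrite count_word_d => -> /=; lia.
  move=> s x E wr _; rewrite rev_rcons /= => xm; rewrite xm {x xm} in E.
  case/lastP: (word lam) E wr => [|v y]; first by case: (s).
  exists v; case: y E wr => // E.
  rewrite -cats1 rows_cat /= cats0 in E.
  have := rows_le 0 v; rewrite E all_rcons => /andP[H _].
  by rewrite -cats1 count_cat /=; move: H; lia.
(* The diagram [mu'] with the expected word also arises from [lam] by the deletion, by [back], so it
   is [mu]. *)
have [||mu' wmu'] := @word_ex (Ld :: v).
- by rewrite -[RHS](count_word_d lam) wl -cats1 count_cat /=; lia.
- by rewrite -[RHS](count_word_r lam) wl -cats1 count_cat /=; lia.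
have [_ mu'E] := back _ _ _ wl wmu'.
exists v; split=> //; rewrite -wmu'; congr word; apply: young_inj.
by rewrite muE mu'E.
Qed.

(** When the first column is full, the border starts with a right step; deleting the column moves
    that step to the end. *)
Lemma del_col_word lam mu : (0 < n)%N ->
  del_col lam mu <->
  exists v, word lam = Lr :: v /\ word mu = rcons v Lr.
Proof.
move=> n0.
have rowsS c w : rows c w = map predn (rows c.+1 w).
  by elim: w c => //= -[] w IH c /=; rewrite IH.
have back (l l' : young n m) v : word l = Lr :: v -> word l' = rcons v Lr -> del_col l l'.
  move=> wl wl'.
  have := rows_word l; rewrite wl /= => E.
  have := rows_word l'; rewrite wl' -cats1 rows_cat /= cats0 rowsS E => E'.
  split; last by apply: (can_inj revK); rewrite -E' map_rev.
  rewrite /c_full /conj_part -(count_rev _ l) -E; apply/eqP.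
  have <- : size (rows 1 v) = n.
    by rewrite size_rows -(count_word_d l) wl.
  by apply/eqP; rewrite -all_count; apply: order_path_min leq_trans (rows_path _ _).
split; last by case=> v [wl wl']; apply: back wl wl'.
case=> /eqP full muE.
have [v wl] : exists v, word lam = Lr :: v.
  case: (word lam) (rows_word lam) (count_word_d lam) => [|[|] v]; first by move=> _ /=; lia.
    by exists v.
  move=> /= E _; exfalso.
  have : all (leq 1) (rev lam).
    rewrite all_rev all_count; apply/eqP; rewrite -[RHS]/(size (val lam)) size_tuple.
    exact: full.
  by rewrite -E.
have [||mu' wmu'] := @word_ex (rcons v Lr).
- by rewrite -[RHS](count_word_d lam) wl -cats1 count_cat /=; lia.
- by rewrite -[RHS](count_word_r lam) wl -cats1 count_cat /=; lia.
have [_ mu'E] := back _ _ _ wl wmu'.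
exists v; split=> //; rewrite -wmu'; congr word; apply: young_inj.
by rewrite muE mu'E.
Qed.

Lemma add_row_del lam mu : (0 < n)%N -> add_row lam mu <-> del_row mu lam.
Proof.
move=> n0; have [sl sm] : size (val lam) = n /\ size (val mu) = n.
  by rewrite !size_tuple.
rewrite /add_row /del_row /r_empty /r_full; split=> -[/eqP E1 E2].
  rewrite E2 /=; split=> //; have := @take_nth _ 0%N n.-1 (val lam).
  by rewrite sl prednK // => /(_ (leqnn _)); rewrite -{1}sl take_size E1.
rewrite E2; move: E1 sm; case: (tval _) => /= [|x s].
  by move=> _ E; move: n0; rewrite -E.
move=> -> <- /=; rewrite nth_rcons ltnn eqxx; split=> //.
by rewrite -cats1 take_size_cat.
Qed.

Lemma add_col_del lam mu : (0 < m)%N -> add_col lam mu <-> del_col mu lam.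
Proof.
move=> m0; have [sl sm] : size (val lam) = n /\ size (val mu) = n.
  by rewrite !size_tuple.
rewrite /add_col /del_col /c_empty /c_full /conj_part; split=> -[/eqP E1 E2].
  rewrite E2; split; last by rewrite -map_comp map_id.
  by rewrite count_map -[X in _ == X]sl -[size _]/(size lam) -all_count; apply/allP.
have a1 : all (leq 1) mu by rewrite all_count -[size _]/(size (val mu)) sm; apply/eqP.
rewrite E2; split.
  rewrite eqn0Ngt -has_count has_map; apply/negP => /hasP[x xm /=].
  have /allP/(_ x xm) := a1; case: (rev_young mu) => _ _ /allP/(_ x).
  by rewrite mem_rev => /(_ xm); lia.
rewrite -map_comp -[LHS]map_id; apply/eq_in_map => x xm /=.
by move/allP/(_ x xm): a1; lia.
Qed.

Lemma diagramE lam (a : 'I_n) (b : 'I_m) :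
  diagram lam (a, b) = (b < nth 0%N (rev lam) a)%N :> Prop.
Proof.
rewrite /diagram /=; have sl := size_tuple lam.
by rewrite nth_rev ?sl ?ltn_ord.
Qed.

Lemma row_le lam a : (nth 0%N (rev lam) a <= m)%N.
Proof.
case: (rev_young lam) => sz _ /allP H.
by have [la|la] := ltnP a n; [apply/H/mem_nth; rewrite sz|rewrite nth_default ?sz].
Qed.

Lemma row_mono lam a b : (a <= b < n)%N ->
  (nth 0%N (rev lam) a <= nth 0%N (rev lam) b)%N.
Proof.
case: (rev_young lam) => sz p _ /andP[ab bn].
apply: (sorted_leq_nth leq_trans leqnn 0%N (path_sorted p)) => //.
  by rewrite inE sz; apply: leq_ltn_trans bn.
by rewrite inE sz.
Qed.

Lemma diagram_inj lam mu : diagram lam = diagram mu -> lam = mu.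
Proof.
move=> E; apply: young_inj; apply: (@eq_from_nth _ 0%N).
  by case: (rev_young lam) (rev_young mu) => -> _ _ [->].
case: (rev_young lam) => -> _ _ a an.
have H (l l' : young n m) : diagram l = diagram l' ->
    (nth 0%N (rev l) a <= nth 0%N (rev l') a)%N.
  move=> Ell'; rewrite leqNgt; apply/negP => lt.
  have bm : (nth 0%N (rev l') a < m)%N by apply: leq_trans (row_le l a).
  have : diagram l (Ordinal an, Ordinal bm) by rewrite diagramE.
  by rewrite Ell' diagramE /= ltnn.
by apply/eqP; rewrite eqn_leq !H.
Qed.

Lemma tbox_opp (a : iso_root n m) lam mu :
  tbox (iso_opp a) lam mu <-> tbox a mu lam.
Proof.
have H (x : 'I_n * 'I_m) l l' : diagram l x /\ diagram l' = (diagram l `\ x)%classic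
    <-> ~ diagram l' x /\ diagram l = (diagram l' `|` [set x])%classic.
  split=> -[lx E].
    rewrite E; split; first by case=> _; apply.
    apply/seteqP; split=> y /=; last by case=> [[]|->].
    by move=> ly; have [->|ne] := pselect (y = x); [right|left].
  rewrite E; split; first by right.
  apply/seteqP; split=> y /=; last by case=> -[ly|].
  by move=> ly; split; [left|move=> yx; apply: lx; rewrite -yx].
case: a => -[] x; rewrite /tbox /=; first by split=> /H.
exact: H.
Qed.

Lemma split_d w a : (a < count is_d w)%N ->
  exists u v, w = u ++ Ld :: v /\ count is_d u = a.
Proof.
elim: w a => [|[] w IH] a //=; rewrite ?add0n.
  by case/IH => u [v [-> <-]]; exists (Lr :: u), v.
case: a => [_|a]; first by exists [::], w.
by rewrite add1n ltnS => /IH[u [v [-> <-]]]; exists (Ld :: u), v.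
Qed.

Lemma split_r w a : (a < count is_r w)%N ->
  exists u v, w = u ++ Lr :: v /\ count is_r u = a.
Proof.
elim: w a => [|[] w IH] a //=; rewrite ?add0n; last first.
  by case/IH => u [v [-> <-]]; exists (Ld :: u), v.
case: a => [_|a]; first by exists [::], w.
by rewrite add1n ltnS => /IH[u [v [-> <-]]]; exists (Lr :: u), v.
Qed.

(** A box can be added exactly where the border turns from down to right. The prefix [u] leads to
    the top left corner of the box, so its letters count the rows above and the columns to the
    left. *)
Lemma tbox_word (a : 'I_n) (b : 'I_m) lam mu :
  tbox (false, (a, b)) lam mu <->
  exists u v, [/\ word lam = u ++ [:: Ld, Lr & v], word mu = u ++ [:: Lr, Ld & v],
    count is_d u = a & count is_r u = b].
Proof.
have rowsE (l : young n m) x u v : word l = u ++ Ld :: x :: v ->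
    rev l = rows 0 u ++ count is_r u :: rows (count is_r u) (x :: v).
  by move=> wl; rewrite -rows_word wl rows_cat add0n.
have back (l l' : young n m) u v :
    word l = u ++ [:: Ld, Lr & v] -> word l' = u ++ [:: Lr, Ld & v] ->
    count is_d u = a -> count is_r u = b -> tbox (false, (a, b)) l l'.
  move=> wl wl' ua ub.
  have E := rowsE _ _ _ _ wl; have := rows_word l'; rewrite wl' rows_cat /= add0n.
  rewrite /= ub in E *; move=> E'.
  have sz : size (rows 0 u) = a by rewrite size_rows.
  split; first by rewrite diagramE E nth_cat sz ltnn subnn /= ltnn.
  apply/seteqP; split=> -[a' b'] /=; rewrite !diagramE E -E' !nth_cat sz.
    case: (ltngtP a' a) => [_|ltaa|/val_inj ->]; try by left.
      by rewrite -[(a' - a)%N]prednK ?subn_gt0 //; left.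
    rewrite subnn /= ltnS leq_eqVlt => /orP[/eqP/val_inj->|]; [by right|by left].
  case=> [|[-> ->]]; last by rewrite ltnn subnn /=.
  by case: (ltnP a' a) => // aa'; case: (a' - a)%N => //= /ltnW.
split; last by case=> u [v [wl wl' ua ub]]; apply: back wl wl' ua ub.
move=> tb; have [/=] := tb; rewrite diagramE => nlt muE.
have ltb : (b < nth 0%N (rev mu) a)%N.
  by rewrite -diagramE muE; right.
have lam_mu (c : 'I_n) (d : 'I_m) : (c, d) != (a, b) -> (d < nth 0%N (rev mu) c)%N ->
    (d < nth 0%N (rev lam) c)%N.
  by move=> ne; rewrite -!diagramE muE => -[//|] /= /eqP; rewrite (negPf ne).
have rowa : nth 0%N (rev lam) a = b.
  apply/eqP; rewrite eqn_leq leqNgt; move/negP: nlt => -> /=.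
  (* The left neighbour of the new box lies in [mu], hence already in [lam]; so row [a] of [lam] has
     exactly [b] boxes. *)
  case E : (val b) => [//|c]; have cm : (c < m)%N by rewrite ltnW // -E ltn_ord.
  apply: (lam_mu a (Ordinal cm)).
    by apply/eqP => -[] /(congr1 val); rewrite E /=; lia.
  by apply: leq_trans ltb; rewrite /= E.
have [|u [v [wl ua]]] := @split_d (word lam) a; first by rewrite count_word_d.
have ub : count is_r u = b.
  by rewrite -rowa -rows_word wl rows_cat nth_cat size_rows ua ltnn subnn.
(* The letter after this down step is [Lr]. The word cannot end here, since only [b < m] right steps
   have occurred. After a second [Ld], the next row of [lam] would also have [b] boxes, although by
   monotonicity of [mu] it contains column [b]. *)
case: v wl => [|[] v] wl.
- have := count_word_r lam; rewrite wl count_cat /= ub.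
  by have := ltn_ord b; lia.
- have [||mu' wmu'] := @word_ex (u ++ [:: Lr, Ld & v]).
  + by rewrite -[RHS](count_word_d lam) wl !count_cat.
  + by rewrite -[RHS](count_word_r lam) wl !count_cat.
  exists u, v; split=> //; rewrite -wmu'; congr word.
  by apply: diagram_inj; rewrite muE; case: (back _ _ _ _ wl wmu' ua ub).
- have an : (a.+1 < n)%N.
    by have := count_word_d lam; rewrite wl count_cat /= ua; lia.
  have : (b < nth 0%N (rev lam) (Ordinal an))%N.
    apply: lam_mu; first by apply/negP => /eqP[/(congr1 val)] /=; lia.
    by apply: leq_trans ltb (row_mono _ _); rewrite /= leqnSn.
  rewrite (rowsE _ _ _ _ wl) nth_cat size_rows ua /= (ltnNge a.+1) leqnSn /= subSnn /=.
  by rewrite ub ltnn.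
Qed.

End Young.

(** * Root spaces *)

Definition real_weight n m (i j : 'I_(n + m)) (s : int) : weights n m :=
  (delta_mx 0 i - delta_mx 0 j, s).

Section Roots.
Variables (k : closedFieldType) (k_char0 : [pchar k] =i pred0) (n m : nat).
Variable frm : 'M[k]_(n + m) -> 'M[k]_(n + m) -> k.
Hypothesis frm_inv : @invariant_form k n m frm.
Local Notation weights := (weights n m).
Local Notation affine := (affine k n m).
Implicit Types (al be : weights) (h x : affine) (s t : int) (i j : 'I_(n + m)).

Lemma intr_eq0_char0 s : (s%:~R == 0 :> k) = (s == 0).
Proof.
have H := (pcharf0P _).1 k_char0.
by case: s => p; rewrite ?NegzE ?mulrNz ?oppr_eq0 -pmulrn H.
Qed.

Lemma intr_inj_char0 : injective (fun s => s%:~R : k).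
Proof.
by move=> s t /eqP; rewrite -subr_eq0 -rmorphB intr_eq0_char0 subr_eq0 => /eqP.
Qed.

(** Diagonal matrices are even, so no sign occurs. *)
Lemma super_bracket_diag (d x : 'M[k]_(n + m)) : is_diag_mx d ->
  super_bracket d x = d *m x - x *m d.
Proof.
case/diag_mxP => r ->; rewrite -(hsubmxK r) diag_mx_row /super_bracket.
rewrite {2}/mx_even {3}/mx_odd block_mxKul block_mxKur block_mxKdl block_mxKdr.
rewrite (_ : block_mx 0 0 0 0 = 0) ?mulmx0 ?subr0; last exact: block_mx0.
congr (_ - _); rewrite -mulmxDl; congr (_ *m _).
by rewrite /mx_even /mx_odd add_block_mx !addr0 !add0r submxK.
Qed.

(** The matrix part of [h] is concentrated in degree 0, which leaves one term of each sum; the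
    cocycle vanishes there because of its factor [a]. *)
Lemma torus_bracketE h x : torus h ->
  affine_bracket frm h x =
  ((fun s => h.1.1 0 *m x.1.1 s - x.1.1 s *m h.1.1 0 + ((h.2 : k) * s%:~R) *: x.1.1 s),
   0, 0).
Proof.
move=> [h0 hd]; have [frmD _ _] := frm_inv.
have frm0 y : frm 0 y = 0.
  have := frmD 1 0 0 y; rewrite scale1r addr0 mul1r => /eqP.
  by rewrite -subr_eq0 opprD addrA subrr add0r oppr_eq0 => /eqP.
have sum0 (V : nmodType) (f : int -> V) : (forall a, a != 0 -> f a = 0) ->
    \sum_(a \in [set: int]) f a = f 0.
  move=> f0; rewrite -(fsbig_widen [set 0] setT); first by rewrite fsbig_set1.
    by [].
  by move=> a /= [_ /eqP a0]; apply: f0.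
rewrite /affine_bracket; congr (_, _, _).
  apply/funext => s; rewrite sum0 => [|a a0]; last first.
    by rewrite h0 // super_bracket_diag ?mul0mx ?mulmx0 ?subrr // mx0_is_diag.
  rewrite subr0 super_bracket_diag //.
  have [->|s0] := eqVneq s 0; first by rewrite mulr0 scale0r mulr0 scale0r subr0.
  by rewrite (h0 s s0) scaler0 subr0.
by rewrite sum0 ?mul0r // => a a0; rewrite h0 // frm0 mulr0.
Qed.

Lemma weight_eval_real i j s h :
  weight_eval (real_weight i j s) h =
  h.1.1 0 i i - h.1.1 0 j j + s%:~R * (h.2 : k).
Proof.
rewrite /weight_eval; congr (_ + _).
have D l : \sum_(t < n + m) ((delta_mx 0 l : 'rV[int]_(n + m)) 0 t)%:~R * h.1.1 0 t t =
    h.1.1 0 l l.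
  rewrite (bigD1 l) //= big1 => [|t tl]; first by rewrite mxE !eqxx mul1r addr0.
  by rewrite mxE (negPf tl) andbF mul0r.
rewrite -[in RHS]D -[h.1.1 0 j j]D -sumrB; apply: eq_bigr => t _.
by rewrite -mulrBl -rmorphB !mxE.
Qed.

(** Diagonal matrix units and [d] read off the coordinates, which are integers and embed in [k] in
    characteristic 0. *)
Lemma weight_eval_inj al be :
  (forall h, torus h -> weight_eval al h = weight_eval be h) -> al = be.
Proof.
move=> H; rewrite [al]surjective_pairing [be]surjective_pairing; congr (_, _).
  apply/rowP => i; apply: intr_inj_char0.
  pose h : affine := ((fun t => if t == 0 then delta_mx i i else 0), 0, 0).
  have /H : torus h.
    split=> [a /negPf a0|]; first by rewrite /= a0.
    apply/is_diag_mxP => a b ab; rewrite /= mxE.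
    by case: eqP => // ai; case: eqP => // bi; case/eqP: ab; rewrite ai bi.
  have D (c : 'rV[int]_(n + m)) :
      \sum_(t < n + m) (c 0 t)%:~R * (delta_mx i i : 'M[k]_(n + m)) t t = (c 0 i)%:~R.
    rewrite (bigD1 i) //= big1 => [|t ti]; first by rewrite mxE !eqxx mulr1 addr0.
    by rewrite mxE (negPf ti) mulr0.
  by rewrite /weight_eval /= !D !mulr0 !addr0.
apply: intr_inj_char0; pose h : affine := ((fun=> 0), 0, 1).
have /H : torus h by split=> //=; exact: mx0_is_diag.
by rewrite /weight_eval /= !mulr1 !big1 ?add0r // => i _; rewrite mxE mulr0.
Qed.

Let ad_entry (a b c e y : k) : a * y - y * b + c * e * y = (a - b + e * c) * y.
Proof. by ring. Qed.

(** The torus scales each matrix entry in each degree by its own weight, so one nonzero entry fixes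
    the weight of [x]. *)
Lemma root_space_entry al x s i j : root_space frm al x ->
  x.1.1 s i j != 0 -> al = real_weight i j s.
Proof.
case=> _ H nz; apply: weight_eval_inj => h th.
have := H h th; rewrite (torus_bracketE _ th) => /(congr1 (fun y : affine => y.1.1 s i j)).
have [_ /diag_mxP[d dE]] := th.
rewrite /= weight_eval_real dE mul_diag_mx mul_mx_diag !mxE !eqxx !mulr1n => E.
by apply: (mulIf nz); rewrite -[LHS]E; exact: ad_entry.
Qed.

(** A root vector without matrix entries would lie in the span of [c] and [d], which has weight 0.
    The case [i = j] covers the imaginary roots. *)
Lemma is_root_real al : is_root frm al ->
  exists i j s, al = real_weight i j s.
Proof.
case=> al0 [x xal xn0]; have [//|no] := pselect (exists i j s, al = real_weight i j s).
have x0 s i j : x.1.1 s i j = 0.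
  apply/eqP/negPn/negP => /(root_space_entry xal) E.
  by apply: no; exists i, j, s.
exfalso; apply: xn0.
have [_ H] := xal.
have E h : torus h -> (weight_eval al h * x.1.2 = 0) /\ (weight_eval al h * x.2 = 0).
  move=> th; have := H h th; rewrite (torus_bracketE _ th) => E; split.
    exact: esym (congr1 (fun y : affine => y.1.2) E).
  exact: esym (congr1 (fun y : affine => y.2) E).
have [h [th hn]] : exists h, torus h /\ weight_eval al h != 0.
  apply: contrapT => K; apply: al0; apply: weight_eval_inj => h th.
  rewrite [RHS](_ : _ = 0); last first.
    rewrite /weight_eval mul0r addr0 big1 // => i _.
    by rewrite mxE mul0r.
  by apply/eqP/negPn/negP => hn; apply: K; exists h.
have [/eqP E1 /eqP E2] := E h th.
move: E1 E2; rewrite !mulf_eq0 (negPf hn) /= => /eqP x1 /eqP x2.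
rewrite [x]surjective_pairing x2 [x.1]surjective_pairing x1; congr (_, _, _).
by apply/funext => s; apply/matrixP => i j; rewrite x0 mxE.
Qed.

Definition loop_delta (i j : 'I_(n + m)) (s : int) : affine :=
  ((fun t => if t == s then delta_mx i j else 0), 0, 0).

Lemma super_trace_delta i j : i != j -> super_trace (delta_mx i j : 'M[k]_(n + m)) = 0.
Proof.
move=> ij; rewrite /super_trace /mxtrace !big1 ?subr0 // => t _; rewrite !mxE.
  by case: eqP => [->|//]; rewrite (negPf ij).
by case: eqP => [->|//]; rewrite (negPf ij).
Qed.

Lemma root_space_loop_delta i j s : i != j ->
  root_space frm (real_weight i j s) (loop_delta i j s).
Proof.
move=> ij; split.
  split; last first.
    move=> a /=; case: eqP => _; first exact: super_trace_delta.
    by rewrite /super_trace /mxtrace !big1 ?subr0 // => t _; rewrite !mxE.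
  apply: sub_finite_set (finite_set1 s) => a /=; case: (eqVneq a s) => //.
  by rewrite eqxx.
move=> h th; rewrite (torus_bracketE _ th).
have [_ /diag_mxP[d dE]] := th.
apply: injective_projections; [apply: injective_projections|];
  rewrite /= ?weight_eval_real ?mulr0 ?scaler0 //.
apply/funext => t; apply/matrixP => a b.
rewrite dE mul_diag_mx mul_mx_diag !mxE !eqxx !mulr1n [LHS]ad_entry.
case: (eqVneq t s) => [->|_]; last by rewrite !mxE !mulr0.
rewrite !mxE; case: eqP => [->|_] /=; last by rewrite !mulr0.
by case: eqP => [->|_] //=; rewrite !mulr0.
Qed.

Lemma loop_delta_neq0 i j s : loop_delta i j s <> 0.
Proof.
move/(congr1 (fun y : affine => y.1.1 s i j)) => /=.
by rewrite eqxx !mxE !eqxx => /eqP; rewrite oner_eq0.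
Qed.

Lemma real_weight_eq1 i j s (t : 'I_(n + m)) : (real_weight i j s).1 0 t = 1 -> t = i.
Proof. by rewrite /= !mxE eqxx /=; case: eqP => // _; case: eqP. Qed.

Lemma real_weight_diag i j s : i != j -> (real_weight i j s).1 0 i = 1.
Proof. by move=> ij; rewrite /= !mxE !eqxx (negPf ij). Qed.

Lemma is_root_real_weight i j s : i != j -> is_root frm (real_weight i j s).
Proof.
move=> ij; split.
  by move/(congr1 (fun w : weights => w.1 0 i)); rewrite real_weight_diag // mxE.
by exists (loop_delta i j s); [exact: root_space_loop_delta|exact: loop_delta_neq0].
Qed.

(* The matrix entry at which the root vector lives vanishes on the Cartan
   subalgebra and on all the other root spaces. *)
Lemma borel_loop_delta base i j s : i != j ->
  borel frm base (loop_delta i j s) <-> is_positive frm base (real_weight i j s).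
Proof.
move=> ij; split=> [B|P]; last first.
  apply: sub_gen_smallest; right; exists (real_weight i j s) => //.
  exact: root_space_loop_delta.
apply: contrapT => nP.
pose W : set affine := [set x : affine | x.1.1 s i j = 0]%classic.
suff /(_ _ B) : (borel frm base `<=` W)%classic.
  by rewrite /W /= eqxx mxE !eqxx => /eqP; rewrite oner_eq0.
apply: smallest_sub.
  split=> [|a x y]; first by rewrite /W /= mxE.
  by rewrite /W /= !mxE => -> ->; rewrite mulr0 addr0.
move=> x [[_ [x0 xd]]|[al /= P xal]]; rewrite /W /=.
  have [->|s0] := eqVneq s 0; last by rewrite x0 // mxE.
  by move/is_diag_mxP: xd; apply.
apply/eqP/negPn/negP => /(root_space_entry xal) E.
by apply: nP; rewrite -E.
Qed.

(** Only the coefficients are reindexed. Together with [ext_diffs_rot], this makes the extended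
    Borel subalgebra insensitive to moving the window. *)
Lemma positive_rot (x : weights) (base : seq weights) :
  is_positive frm (x :: base) = is_positive frm (rcons base x).
Proof.
apply/funext => al; apply/propext; split=> -[ral [c E]]; split=> //.
  exists (fun p => if p == size base then c 0%N else c p.+1).
  rewrite E size_rcons big_ord_recl big_ord_recr /= nth_rcons ltnn eqxx addrC.
  congr (_ + _); apply: eq_bigr => p _.
  by rewrite nth_rcons ltn_ord (ltn_eqF (ltn_ord p)).
exists (fun p => if p is q.+1 then c q else c (size base)).
rewrite E size_rcons [LHS]big_ord_recr [RHS]big_ord_recl /= nth_rcons ltnn eqxx addrC.
by congr (_ + _); apply: eq_bigr => p _; rewrite nth_rcons ltn_ord.
Qed.

Lemma borel_rot (x : weights) base : borel frm (x :: base) = borel frm (rcons base x).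
Proof. by rewrite /borel positive_rot. Qed.

End Roots.

(** * Ordered bases *)

Definition diffs n m (W : seq (weights n m)) : seq (weights n m) :=
  mkseq (fun p => W`_p - W`_p.+1) (size W).-1.

(** An ordering of all the [eps] and [del], each shifted by a multiple of the imaginary root;
    [diffs W] is then a list of simple roots. *)
Definition frame n m (W : seq (weights n m)) : Prop :=
  exists (f : 'I_(n + m) -> 'I_(n + m)) (s : 'I_(n + m) -> int),
  [/\ injective f, size W = (n + m)%N &
      forall p : 'I_(n + m), W`_p = (delta_mx 0 (f p), s p)].

Lemma imag_rootMn n m d : imag_root n m *+ d = (0, d%:Z).
Proof.
elim: d => // d IH; rewrite mulrS IH; apply: injective_projections => /=.
  by rewrite addr0.
by rewrite -[RHS]/(1 + d)%N%:Z PoszD.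
Qed.

Section Frames.
Variables (k : closedFieldType) (k_char0 : [pchar k] =i pred0) (n m : nat).
Variable frm : 'M[k]_(n + m) -> 'M[k]_(n + m) -> k.
Hypothesis frm_inv : @invariant_form k n m frm.
Local Notation weights := (weights n m).
Local Notation N := (n + m)%N.
Implicit Types (W : seq weights).

Lemma size_diffs W : size (diffs W) = (size W).-1.
Proof. exact: size_mkseq. Qed.

Lemma nth_diffs W p : (p.+1 < size W)%N -> (diffs W)`_p = W`_p - W`_p.+1.
Proof. by move=> H; rewrite nth_mkseq //; lia. Qed.

Lemma frame_sub W p q : frame W -> (p < N)%N -> (q < N)%N -> p != q ->
  exists i j s, i != j /\ W`_p - W`_q = real_weight i j s.
Proof.
case=> f [s [fI sW E]] pN qN pq; pose p' := Ordinal pN; pose q' := Ordinal qN.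
exists (f p'), (f q'), (s p' - s q'); split.
  by apply: contra pq => /eqP/fI/(congr1 val)/= ->.
by rewrite (E p') (E q').
Qed.

Lemma frame_root W p q : frame W -> (p < N)%N -> (q < N)%N -> p != q ->
  is_root frm (W`_p - W`_q).
Proof.
by move=> fW pN qN /(frame_sub fW pN qN)[i [j [s [ij ->]]]]; apply: is_root_real_weight.
Qed.

(** Two coordinates of the sum equal 1, whereas a root has at most one such coordinate. *)
Lemma frame_not_root W a b c d : frame W ->
  (a < N)%N -> (b < N)%N -> (c < N)%N -> (d < N)%N -> uniq [:: a; b; c; d] ->
  ~ is_root frm (W`_a - W`_b + (W`_c - W`_d)).
Proof.
case=> f [s [fI sW E]] aN bN cN dN U /(is_root_real k_char0 frm_inv)[i [j [t]]].
pose a' := Ordinal aN; pose b' := Ordinal bN; pose c' := Ordinal cN; pose d' := Ordinal dN.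
rewrite (E a') (E b') (E c') (E d') => /(congr1 (@fst _ _)) R.
have ne (x y : 'I_N) : val x != val y -> (f x == f y) = false.
  by move=> xy; apply: contraNF xy => /eqP/fI ->.
move: U; rewrite /= !inE !negb_or -!andbA => /and5P[ab ac ad bc /and3P[bd cd _]].
have /real_weight_eq1 ai : (real_weight i j t).1 0 (f a') = 1.
  by rewrite -R /= !mxE !eqxx !ne // eq_sym.
have /real_weight_eq1 ci : (real_weight i j t).1 0 (f c') = 1.
  by rewrite -R /= !mxE !eqxx !ne // eq_sym.
by move: ac; rewrite -[a]/(val a') -[c]/(val c') (fI _ _ (etrans ai (esym ci))) eqxx.
Qed.

(** Exchanging [w1] and [w2] negates their difference. A neighbouring simple root plus [w1 - w2] is
    again a difference of two entries, hence a root; for the other simple roots four distinct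
    entries are involved and the sum is not a root. *)
Lemma odd_reflection_swap u w1 w2 v : frame (u ++ [:: w1, w2 & v]) ->
  odd_reflection frm (size u) (diffs (u ++ [:: w1, w2 & v])) =
  diffs (u ++ [:: w2, w1 & v]).
Proof.
set W := u ++ _; set W' := u ++ _; set p := size u => fW.
have sW : size W = N by case: fW => f [s []].
have sE : size W' = size W by rewrite !size_cat.
have pN : (p.+1 < N)%N by rewrite -sW size_cat -[size u]/p /= !addnS !ltnS leq_addr.
have W'E q : W'`_q = if q == p then W`_p.+1 else if q == p.+1 then W`_p else W`_q.
  rewrite !nth_cat -/p ltnn subnn (ltnNge p.+1) leqnSn subSnn /=.
  case: (ltngtP q p) => [qp|pq|->]; last by rewrite subnn.
    by rewrite (ltn_eqF (leq_trans qp (leqnSn p))).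
  case: (eqVneq q p.+1) => [->|qn]; first by rewrite subSnn.
  by have [r ->] : exists r, (q - p = r.+2)%N by exists (q - p).-2; lia.
apply: (@eq_from_nth _ 0); first by rewrite size_mkseq !size_diffs sE.
rewrite size_mkseq size_diffs sW => q qN.
rewrite nth_mkseq ?size_diffs ?sW // (nth_diffs (W := W')) ?sE ?sW; last by lia.
rewrite !nth_diffs ?sW; try lia; rewrite !W'E.
case: (eqVneq q p) => [->|qp].
  by rewrite (gtn_eqF (ltnSn _)) eqxx opprB.
have [Ep|nEp] := eqVneq q.+1 p.
  rewrite -Ep (ltn_eqF (_ : (q < q.+2)%N)) ?ltnS //.
  by rewrite addrA subrK asboolT //; apply: frame_root => //; lia.
have [Eq|nEq] := eqVneq q p.+1.
  rewrite Eq eqSS (gtn_eqF (ltnSn _)) addrC addrA subrK asboolT //.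
  by apply: frame_root => //; lia.
rewrite eqSS (negPf qp) asboolF //.
by apply: frame_not_root => //; rewrite /= ?inE; lia.
Qed.

(** Telescoping, with indicators as coefficients so that sums for different [p] can be combined
    termwise. *)
Lemma sum_diffs_tail W p : (p < size W)%N ->
  \sum_(t < (size W).-1) (W`_t - W`_t.+1) *+ (p <= t)%N = W`_p - W`_(size W).-1.
Proof.
move=> pW; have pW' : (p <= (size W).-1)%N by lia.
rewrite -(big_mkord xpredT (fun t => (W`_t - W`_t.+1) *+ (p <= t)%N)) //.
rewrite (@big_cat_nat _ _ _ p) //= big_nat_cond big1 ?add0r => [|t /andP[/andP[_ tp] _]].
   rewrite -[LHS]opprK -sumrN -opprB -(telescope_sumr (fun t => W`_t) pW').
  congr (- _); apply: eq_big_nat => t /andP[pt _].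
  by rewrite pt mulr1n opprB.
by rewrite leqNgt tp.
Qed.

Lemma ext_root_diffs W : (0 < size W)%N ->
  ext_root (diffs W) = imag_root n m - (W`_0 - W`_(size W).-1).
Proof.
move=> W0; rewrite /ext_root; congr (_ - _); rewrite -(sum_diffs_tail W0).
rewrite (big_nth 0) big_mkord size_diffs; apply: eq_bigr => t _.
by rewrite nth_diffs // ; have := ltn_ord t; lia.
Qed.

(** The height of this root is [q - p + N d]. It is nonnegative on positive roots, and [q - p] is
    nonzero of absolute value below [N], which gives the criterion; conversely, coefficients are
    exhibited. *)
Lemma frame_positive W p q (d : int) : frame W -> (p < N)%N -> (q < N)%N -> p != q ->
  is_positive frm (ext_root (diffs W) :: diffs W) (W`_p - W`_q + (0, d)) <->
  (0 < d) || (d == 0) && (p < q)%N.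
Proof.
move=> fW pN qN pq; have sW : size W = N by case: fW => f [s []].
have sumE (c : nat -> nat) :
  \sum_(t < size (ext_root (diffs W) :: diffs W))
      (ext_root (diffs W) :: diffs W)`_t *+ c t =
    (imag_root n m - (W`_0 - W`_N.-1)) *+ c 0%N +
    \sum_(t < N.-1) (W`_t - W`_t.+1) *+ c t.+1.
  rewrite /= big_ord_recl /= ext_root_diffs ?sW; last by lia.
  congr (_ + _); rewrite size_diffs sW; apply: eq_bigr => t _.
  by rewrite /= /bump leq0n add1n nth_diffs // sW; have := ltn_ord t; lia.
split=> [[_ [c]]|].
  rewrite sumE => E; case: fW => f [s [fI _ WE]].
  (* [ht] takes the value [- r] on [W`_r], hence 1 on every simple root. *)
  pose ht (al : weights) : int :=
    \sum_(r < N) al.1 0 (f r) * (- r%:Z - N%:Z * s r) + N%:Z * al.2.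
  have htD al be : ht (al + be) = ht al + ht be.
    rewrite /ht addrACA -mulrDr -big_split; congr (_ + _).
    by apply: eq_bigr => r _ /=; rewrite -mulrDl mxE.
  have ht0 : ht 0 = 0.
    by rewrite /ht mulr0 addr0 big1 // => r _; rewrite mxE mul0r.
  have htN al : ht (- al) = - ht al.
    by apply/eqP; rewrite -addr_eq0 -htD addNr ht0.
  have htMn al r : ht (al *+ r) = ht al *+ r.
    by elim: r => [|r IH]; rewrite ?ht0 // !mulrS htD IH.
  have htW r : (r < N)%N -> ht W`_r = - r%:Z.
    move=> rN; rewrite (WE (Ordinal rN)) /ht (bigD1 (Ordinal rN)) //= big1.
      by rewrite mxE !eqxx mul1r addr0 subrK.
    by move=> t tr; rewrite mxE (inj_eq fI) (negPf tr) andbF mul0r.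
  have htI e : ht (0, e) = N%:Z * e.
    by rewrite /ht big1 ?add0r // => r _; rewrite mxE mul0r.
  have ge0 : 0 <= ht (W`_p - W`_q + (0, d)).
    rewrite E htD htMn; apply: addr_ge0.
      apply: mulrn_wge0; rewrite htD htN htD htN htI !htW; lia.
    rewrite (big_morph ht htD ht0); apply: sumr_ge0 => t _.
    rewrite htMn; apply: mulrn_wge0; have := ltn_ord t => tN.
    rewrite htD htN !htW; lia.
  move: ge0; rewrite htD htI htD htN !htW //; nia.
move=> dE; split.
  have [i [j [s [ij ->]]]] := frame_sub fW pN qN pq.
  rewrite (_ : _ + _ = real_weight i j (s + d)); first exact: is_root_real_weight.
  by apply: injective_projections; rewrite //= addr0.
have [e de] : exists e : nat, d = e%:Z by exists `|d|%N; lia.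
rewrite {}de in dE *.
(* All simple roots taken [e] times give [e] times the imaginary root; the indicators contribute the
   difference of entries [p] and [q]. The subtraction is not truncated, since either [e > 0] or
   [p < q]. *)
pose c t := (if t is t'.+1 then e + (p <= t') - (q <= t') else e)%N.
exists c; rewrite (sumE c) /= mulrnBl imag_rootMn.
under eq_bigr => t _.
  rewrite mulrnBr; last by move: dE; lia.
  rewrite mulrnDr; over.
have T r : (r < N)%N ->
    \sum_(t < N.-1) (W`_t - W`_t.+1) *+ (r <= t)%N = W`_r - W`_N.-1.
  by move=> rN; have := @sum_diffs_tail W r; rewrite sW; apply.
rewrite sumrB big_split /= !T // sumrMnl.
have <- : W`_0 - W`_N.-1 = \sum_(t < N.-1) (W`_t - W`_t.+1).
  rewrite -T; last by lia.
  by apply: eq_bigr => t _.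
by rewrite [RHS]addrA [X in _ = X + _]addrA subrK -[RHS]addrA opprB subrKA addrC.
Qed.

End Frames.

(** * Rotating a base through the extending root *)

Section DiffsRot.
Variables n m : nat.
Implicit Types (W V : seq (weights n m)) (x : weights n m).

Lemma diffs_cons x V : (0 < size V)%N -> diffs (x :: V) = (x - V`_0) :: diffs V.
Proof.
case: V => // y V _; rewrite /diffs /mkseq /=; congr cons.
by rewrite (iotaDl 1 0) -map_comp.
Qed.

Lemma diffs_rcons x V : (0 < size V)%N ->
  diffs (rcons V x) = rcons (diffs V) (V`_(size V).-1 - x).
Proof.
case: V => // y V _; rewrite /diffs size_rcons /= mkseqS; congr rcons.
  apply/eq_in_map => p; rewrite mem_iota /= add0n => pV.
  by rewrite -?rcons_cons !nth_rcons /= !ltnS pV (ltnW pV).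
by rewrite -?rcons_cons !nth_rcons /= ltnn eqxx ltnSn.
Qed.

Lemma ext_root_rcons x V : (0 < size V)%N ->
  ext_root (diffs (rcons V x)) = x + imag_root n m - V`_0.
Proof.
case: V => // y V _; rewrite ext_root_diffs ?size_rcons // nth_rcons /=.
by rewrite -?rcons_cons nth_rcons /= ltnn eqxx opprB addrA [_ + x]addrC.
Qed.

Lemma ext_root_cons x V : (0 < size V)%N ->
  ext_root (diffs (x :: V)) = V`_(size V).-1 - (x - imag_root n m).
Proof.
case: V => // y V _; rewrite ext_root_diffs //= !opprB addrCA.
by congr (_ + _).
Qed.

(** Moving the last entry to the front, one period back, makes the extending root the first simple
    root. *)
Lemma diffs_rot x V : (0 < size V)%N ->
  take (size (diffs (rcons V x))) (ext_root (diffs (rcons V x)) :: diffs (rcons V x)) =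
  diffs (x + imag_root n m :: V).
Proof.
move=> V0; rewrite ext_root_rcons // diffs_cons // diffs_rcons // size_rcons /=.
by rewrite -cats1 take_size_cat.
Qed.

Lemma diffs_rotr x V : (0 < size V)%N ->
  rcons (behead (diffs (x :: V))) (ext_root (diffs (x :: V))) =
  diffs (rcons V (x - imag_root n m)).
Proof. by move=> V0; rewrite ext_root_cons // diffs_cons // diffs_rcons. Qed.

(** Both extended bases consist of the differences along one period of the same path, from
    consecutive starting points. *)
Lemma ext_diffs_rot x V : (0 < size V)%N ->
  exists y B, ext_root (diffs (rcons V x)) :: diffs (rcons V x) = rcons B y /\
    ext_root (diffs (x + imag_root n m :: V)) :: diffs (x + imag_root n m :: V) = y :: B.
Proof.
move=> V0; exists (V`_(size V).-1 - x), (x + imag_root n m - V`_0 :: diffs V).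
rewrite ext_root_rcons // ext_root_cons // addrK; split.
  by rewrite diffs_rcons.
by rewrite diffs_cons.
Qed.

End DiffsRot.

(** * Weights along the border *)

(* The weights of the down step in row [x + 1] and of the right step in column
   [y + 1] of the bi-infinite periodic border, whose period subtracts the basic
   imaginary root. *)
Definition eps_aff n m (x : int) : weights n m :=
  ((evec n m `|(x %% n)%Z|).1, - (x %/ n)%Z).
Definition del_aff n m (y : int) : weights n m :=
  ((evec n m (n + `|(y %% m)%Z|)).1, - (y %/ m)%Z).

Fixpoint steps n m (x y : int) (w : seq letter) : seq (weights n m) :=
  match w with
  | [::] => [::]
  | Ld :: w' => eps_aff n m x :: steps n m (x + 1) y w'
  | Lr :: w' => del_aff n m y :: steps n m x (y + 1) w'
  end.

Section Steps.
Variables (n m : nat) (n_gt0 : (0 < n)%N) (m_gt0 : (0 < m)%N).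
Local Notation steps := (steps n m).
Local Notation eps_aff := (eps_aff n m).
Local Notation del_aff := (del_aff n m).
Local Notation N := (n + m)%N.
Implicit Types (u v w : seq letter) (x y t : int) (lam mu : young n m).

Lemma size_steps x y w : size (steps x y w) = size w.
Proof. by elim: w x y => //= -[] w IH x y /=; rewrite IH. Qed.

Lemma steps_cat x y u w :
  steps x y (u ++ w) = steps x y u ++ steps (x + (count is_d u)%:Z) (y + (count is_r u)%:Z) w.
Proof.
elim: u x y => [|[] u IH] x y /=; rewrite ?addr0 //= IH ?add0n ?add1n.
  by rewrite -addrA -intS.
by rewrite -addrA -intS.
Qed.

Lemma eps_affD x t : eps_aff (x + t * n%:Z) = eps_aff x - (0, t).
Proof.
rewrite /eps_aff [x + _]addrC modzMDl divzMDl; last by lia.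
by rewrite opprD addrC; apply: injective_projections; rewrite //= subr0.
Qed.

Lemma del_affD y t : del_aff (y + t * m%:Z) = del_aff y - (0, t).
Proof.
rewrite /del_aff [y + _]addrC modzMDl divzMDl; last by lia.
by rewrite opprD addrC; apply: injective_projections; rewrite //= subr0.
Qed.

Lemma eps_aff_nat (a : nat) : (a < n)%N -> eps_aff a = evec n m a.
Proof. by move=> an; rewrite /eps_aff modz_nat divz_nat modn_small // divn_small. Qed.

Lemma del_aff_nat (b : nat) : (b < m)%N -> del_aff b = evec n m (n + b).
Proof. by move=> bm; rewrite /del_aff modz_nat divz_nat modn_small // divn_small. Qed.

Lemma steps_shift x y t w :
  steps (x + t * n%:Z) (y + t * m%:Z) w = [seq z - (0, t) | z <- steps x y w].
Proof.
elim: w x y => //= -[] w IH x y /=; first by rewrite del_affD addrAC IH.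
by rewrite eps_affD addrAC IH.
Qed.

(** A translation by whole periods subtracts the same imaginary weight from all labels, which
    cancels in differences. *)
Lemma diffs_steps_shift x y t w :
  diffs (steps (x + t * n%:Z) (y + t * m%:Z) w) = diffs (steps x y w).
Proof.
rewrite steps_shift /diffs size_map; apply/eq_in_map => p.
rewrite mem_iota add0n ltn_predRL => pw; rewrite !(nth_map 0) ?(ltnW pw) //.
by rewrite opprB addrA subrK.
Qed.

Lemma nth_steps x y w p : (p < size w)%N ->
  (steps x y w)`_p =
  if is_r (nth Lr w p) then del_aff (y + (count is_r (take p w))%:Z)
  else eps_aff (x + (count is_d (take p w))%:Z).
Proof.
move=> pw; rewrite -{1}(cat_take_drop p w) steps_cat nth_cat size_steps.
rewrite size_takel ?ltnn ?subnn; last exact: ltnW.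
by rewrite (drop_nth Lr pw); case: (nth Lr w p).
Qed.

Lemma count_take_lt (a : pred letter) w p q : (p < q)%N -> (q <= size w)%N ->
  a (nth Lr w p) -> (count a (take p w) < count a (take q w))%N.
Proof.
move=> pq qw ap; have pw : (p < size w)%N by apply: leq_trans qw.
apply: (@leq_trans (count a (take p.+1 w))).
  by rewrite (take_nth Lr pw) -cats1 count_cat /= ap addn1.
by rewrite -(cat_take_drop p.+1 (take q w)) count_cat take_takel // leq_addr.
Qed.

Lemma evecE (c : 'I_N) : (evec n m c).1 = delta_mx 0 c.
Proof. by apply/rowP => i; rewrite !mxE eqxx /= natz. Qed.

(** The down steps occupy [n] consecutive rows and the right steps [m] consecutive columns, so their
    residues are distinct. *)
Lemma frame_steps x y w : count is_d w = n -> count is_r w = m ->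
  frame (steps x y w).
Proof.
move=> wd wr.
have sw : size w = N.
  by rewrite -(count_predC is_d) wd -wr; congr addn; apply: eq_count => -[].
(* The label of step [p] is the basis vector of index [v p], with imaginary part [s p]. *)
pose v p := (if is_r (nth Lr w p) then n + `|((y + (count is_r (take p w))%:Z) %% m)%Z|
  else `|((x + (count is_d (take p w))%:Z) %% n)%Z|)%N.
pose s p := if is_r (nth Lr w p) then - ((y + (count is_r (take p w))%:Z) %/ m)%Z
  else - ((x + (count is_d (take p w))%:Z) %/ n)%Z.
have modlt (z : int) (d : nat) : (0 < d)%N -> (`|(z %% d)%Z| < d)%N by lia.
have vN p : (v p < N)%N.
  rewrite /v; case: ifP => _; first by rewrite ltn_add2l modlt.
  by apply: ltn_addr; apply: modlt.
have modI (z : int) (a b d : nat) : (a < b < d)%N ->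
    `|((z + a%:Z) %% d)%Z|%N != `|((z + b%:Z) %% d)%Z|%N.
  move=> /andP[ab bd]; apply/eqP => E.
  have /eqP : ((z + a%:Z) %% d)%Z = ((z + b%:Z) %% d)%Z.
    have d0 : d%:Z != 0 by lia.
    move: E (modz_ge0 (z + a%:Z) d0) (modz_ge0 (z + b%:Z) d0).
    by move: (modz _ _) (modz _ _) => c c'; lia.
  by rewrite eqz_modDl !modz_nat !modn_small //; lia.
have vI (p q : nat) : (p < q < N)%N -> v p != v q.
  move=> /andP[pq qN]; have qw : (q < size w)%N by rewrite sw.
  have cl (a : pred letter) : a (nth Lr w p) -> a (nth Lr w q) ->
      (count a (take p w) < count a (take q w) < count a w)%N.
    move=> ap aq; rewrite count_take_lt //; last exact: ltnW.
    by rewrite -[X in (_ < count _ X)%N](take_size w) count_take_lt.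
  rewrite /v; case Ep : (nth Lr w p); case Eq : (nth Lr w q) => /=.
  - by rewrite eqn_add2l; apply: modI; rewrite -wr cl ?Ep ?Eq.
  - by have := modlt (x + (count is_d (take q w))%:Z) n n_gt0; lia.
  - by have := modlt (x + (count is_d (take p w))%:Z) n n_gt0; lia.
  - by apply: modI; rewrite -wd cl ?Ep ?Eq.
exists (fun p => Ordinal (vN p)), s; split.
- move=> p q /(congr1 val)/= E; apply: val_inj => /=.
  have := vI p q; have := vI q p; rewrite E eqxx !ltn_ord !andbT.
  by case: ltngtP => // _ H1 H2; [have := H1 isT|have := H2 isT].
- by rewrite size_steps.
- move=> p; rewrite nth_steps ?sw // -evecE /s /=.
  by rewrite /v; case: (nth Lr w p).
Qed.

Lemma frame_steps_word x y lam : frame (steps x y (word lam)).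
Proof. by apply: frame_steps; rewrite ?count_word_d ?count_word_r. Qed.

(** In the window at the origin no row or column index leaves its first period, so the affine labels
    are those of the shuffle. *)
Lemma local_rootsE lam : local_roots lam = diffs (steps 0 0 (word lam)).
Proof.
have H p : (p < N)%N -> evec n m (nth 0%N (shuffle lam) p) = (steps 0 0 (word lam))`_p.
  move=> pN; have pw : (p < size (word lam))%N by rewrite size_word.
  rewrite nth_steps // (nth_map 0%N) ?size_iota // nth_iota // !add0r add0n.
  have cl (a : pred letter) : a (nth Lr (word lam) p) ->
      (count a (take p (word lam)) < count a (word lam))%N.
    by move=> ap; rewrite -[X in (_ < count _ X)%N](take_size (word lam)) count_take_lt.
  case E : (nth Lr _ p) => /=.
    by rewrite del_aff_nat // -[X in (_ < X)%N](count_word_r lam) cl ?E.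
  by rewrite eps_aff_nat // -[X in (_ < X)%N](count_word_d lam) cl ?E.
rewrite /local_roots /diffs size_steps size_word; apply/eq_in_map => p.
by rewrite mem_iota add0n => pN; rewrite !H //; lia.
Qed.

Lemma lincomb_eq i j i' j' : coprime n m -> lincomb n m i j = lincomb n m i' j' ->
  exists t, i' = i + t * m%:Z /\ j' = j - t * n%:Z.
Proof.
rewrite /lincomb => co E.
have E' : (i' - i) * n%:Z = (j - j') * m%:Z by lia.
have /dvdzP[t it] : (m %| i' - i)%Z.
  rewrite -(@Gauss_dvdzl _ _ n%:Z) ?E' ?dvdz_mull //.
  by rewrite coprimezE /= coprime_sym.
exists t; split; first by lia.
have : (t * n%:Z - (j - j')) * m%:Z = 0 by rewrite mulrBl -E' it; ring.
by move/eqP; rewrite mulf_eq0; lia.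
Qed.

Lemma lincomb_ex (k : int) : coprime n m -> exists i j, k = lincomb n m i j.
Proof.
move=> co; have : coprimez n%:Z m%:Z by rewrite coprimezE.
case/coprimezP => -[a b] /= E; exists (k * a), (k * b).
by rewrite /lincomb -!mulrA -mulrDr E mulr1.
Qed.

End Steps.

(** * Windows on the periodic border *)

Definition window_base n m (lam : young n m) (i j : int) : seq (weights n m) :=
  diffs (steps n m (- j) i (word lam)).

Section Windows.
Variables n m : nat.
Local Notation N := (n + m)%N.
Implicit Types (lam mu : young n m) (i j : int) (u v w : seq letter).

(** The corner of a removable box for [true], of an addable one for [false], matching the sign bit
    of [iso_root]. *)
Definition swapped (s : bool) : seq letter := if s then [:: Lr; Ld] else [:: Ld; Lr].

Lemma tbox_swap (a : iso_root n m) lam mu :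
  tbox a lam mu <->
  exists u v, [/\ word lam = u ++ swapped a.1 ++ v, word mu = u ++ swapped (~~ a.1) ++ v,
    count is_d u = a.2.1 & count is_r u = a.2.2].
Proof.
case: a => -[] [a b] /=; last exact: tbox_word.
rewrite -[(true, (a, b))]/(iso_opp (false, (a, b))).
split=> [/tbox_opp/tbox_word|] [u [v [*]]]; first by exists u, v.
by apply/tbox_opp/tbox_word; exists u, v.
Qed.

Lemma tbox_young0 lam : lam <> young0 n m ->
  exists (a : iso_root n m) mu, [/\ a.1, tbox a lam mu & (sumn mu < sumn lam)%N].
Proof.
(* A word without a removable corner has all its down steps first, as the word of the empty diagram
   does. *)
have dr w : (exists u v, w = u ++ [:: Lr, Ld & v]) \/
    (exists a b, w = nseq a Ld ++ nseq b Lr).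
  elim: w => [|x w [[u [v ->]]|[a [b ->]]]]; first by right; exists 0%N, 0%N.
    by left; exists (x :: u), v.
  case: x; last by right; exists a.+1, b.
  case: a => [|a]; first by right; exists 0%N, b.+1.
  by left; exists [::], (nseq a Ld ++ nseq b Lr).
have word0 : word (young0 n m) = nseq n Ld ++ nseq m Lr.
  rewrite /word /= rev_nseq; elim: (n) => [|p IH] /=; first by rewrite subn0.
  by rewrite IH.
move=> lam0; case: (dr (word lam)) => [[u [v wl]]|[a [b wl]]]; last first.
  case: lam0; apply: word_inj; rewrite wl word0.
  have := count_word_d lam; have := count_word_r lam.
  rewrite wl !count_cat !count_nseq /= !mul0n !mul1n add0n addn0 => -> ->.
  by [].
have := count_word_d lam; have := count_word_r lam.
rewrite wl !count_cat /= => ur ud.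
have un : (count is_d u < n)%N by lia.
have um : (count is_r u < m)%N by lia.
have [||mu wm] := @word_ex n m (u ++ [:: Ld, Lr & v]).
- by rewrite count_cat /=; lia.
- by rewrite count_cat /=; lia.
exists (true, (Ordinal un, Ordinal um)), mu; split=> //.
  by apply/tbox_swap; exists u, v.
rewrite -(sumn_rev mu) -(sumn_rev lam) -!rows_word wl wm !rows_cat !sumn_cat /=.
lia.
Qed.

(** Deleting boxes one at a time leads from any diagram to the empty one, and these moves can be
    reversed. *)
Lemma young_connected (P : young n m -> Prop) :
  (forall a lam mu, tbox a lam mu -> P lam -> P mu) -> forall lam mu, P lam -> P mu.
Proof.
move=> H; have E : forall lam, P lam <-> P (young0 n m).
  move=> lam; have [s] := ubnP (sumn lam); elim: s lam => // s IH lam lt.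
  have [->//|/tbox_young0[a [mu [_ tb ltm]]]] := pselect (lam = young0 n m).
  rewrite -(IH mu); last by apply: leq_trans ltm _.
  by split; [apply: H tb|apply: H; apply/tbox_opp; exact: tb].
by move=> lam mu /(proj1 (E _)) P0; apply: (proj2 (E mu)) P0.
Qed.

Hypothesis n_gt0 : (0 < n)%N.

Lemma del_row_ex v : count is_d v = n.-1 -> count is_r v = m ->
  exists lam mu : young n m, [/\ word lam = rcons v Ld, word mu = Ld :: v & del_row lam mu].
Proof.
move=> vd vr; have [||lam wl] := @word_ex n m (rcons v Ld).
- by rewrite -cats1 count_cat /=; lia.
- by rewrite -cats1 count_cat /=; lia.
have [||mu wm] := @word_ex n m (Ld :: v); rewrite /=; try lia.
by exists lam, mu; split=> //; apply/(del_row_word _ _ n_gt0); exists v.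
Qed.

Hypothesis m_gt0 : (0 < m)%N.

Lemma window_base_eq lam i j i' j' : coprime n m -> lincomb n m i j = lincomb n m i' j' ->
  window_base lam i j = window_base lam i' j'.
Proof.
move=> co /(lincomb_eq n_gt0 m_gt0 co)[t [-> ->]].
by rewrite /window_base opprB addrC diffs_steps_shift.
Qed.

(** The window moves back by one step: its last down step, in row [- j - 1 + n], is replaced by the
    one a period earlier, whose label is larger by the imaginary root. *)
Lemma window_base_row lam mu i j : del_row lam mu ->
  exists V z, [/\ (0 < size V)%N, window_base lam i j = diffs (rcons V z) &
    window_base mu i (j + 1) = diffs (z + imag_root n m :: V)].
Proof.
case/(del_row_word _ _ n_gt0) => v [wl wm].
have vd := count_word_d lam; have vr := count_word_r lam.
rewrite wl -cats1 !count_cat /= in vd vr.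
exists (steps n m (- j) i v), (eps_aff n m (- j - 1 + 1 * n%:Z)); split.
- by rewrite size_steps (leq_trans _ (count_size is_r v)) //; lia.
- rewrite /window_base wl -cats1 steps_cat cats1 /=; congr (diffs (rcons _ (eps_aff _ _ _))); lia.
- rewrite /window_base wm /= eps_affD // subrK.
  congr (diffs (eps_aff _ _ _ :: steps _ _ _ _ _)); lia.
Qed.

(** Here the window moves forward by one step: the right step at [i] leaves it and the one at
    [i + m] enters. *)
Lemma window_base_col lam mu i j : del_col lam mu ->
  exists V z, [/\ (0 < size V)%N, window_base mu (i + 1) j = diffs (rcons V z) &
    window_base lam i j = diffs (z + imag_root n m :: V)].
Proof.
case/(del_col_word _ _ n_gt0) => v [wl wm].
have vd := count_word_d lam; have vr := count_word_r lam.
rewrite wl /= in vd vr.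
exists (steps n m (- j) (i + 1) v), (del_aff n m (i + 1 * m%:Z)); split.
- by rewrite size_steps (leq_trans _ (count_size is_d v)) //; lia.
- rewrite /window_base wm -cats1 steps_cat cats1 /=; congr (diffs (rcons _ (del_aff _ _ _))); lia.
- by rewrite /window_base wl /= del_affD // subrK.
Qed.

Lemma del_col_ex v : count is_d v = n -> count is_r v = m.-1 ->
  exists lam mu : young n m, [/\ word lam = Lr :: v, word mu = rcons v Lr & del_col lam mu].
Proof.
move=> vd vr; have [||mu wm] := @word_ex n m (rcons v Lr).
- by rewrite -cats1 count_cat /=; lia.
- by rewrite -cats1 count_cat /=; lia.
have [||lam wl] := @word_ex n m (Lr :: v); rewrite /=; try lia.
by exists lam, mu; split=> //; apply/(del_col_word _ _ n_gt0); exists v.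
Qed.

(* One step of the start of the window forwards along the periodic border. *)
Lemma window_succ lam i j : exists mu i' j', i' - j' = i - j + 1 /\
  (class_step (lam, lincomb n m i j) (mu, lincomb n m i' j') \/
   class_step (mu, lincomb n m i' j') (lam, lincomb n m i j)).
Proof.
have := count_word_d lam; have := count_word_r lam.
case wl : (word lam) => [|[] v] /=; first by lia.
  move=> vr vd; have [||lam' [mu [wl' wm dc]]] := @del_col_ex v; try lia.
  have <- : lam' = lam by apply: word_inj; rewrite wl wl'.
  exists mu, (i + 1), j; split; first by ring.
  left; rewrite (_ : lincomb n m (i + 1) j = lincomb n m i j + n%:Z); first by constructor.
  by rewrite /lincomb; ring.
move=> vr vd; have [||mu [lam' [wm wl' dr]]] := @del_row_ex v; try lia.
have <- : lam' = lam by apply: word_inj; rewrite wl wl'.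
exists mu, i, (j - 1); split; first by ring.
right; rewrite (_ : lincomb n m i j = lincomb n m i (j - 1) + m%:Z); first by constructor.
by rewrite /lincomb; ring.
Qed.

Lemma window_pred lam i j : exists mu i' j', i' - j' = i - j - 1 /\
  (class_step (lam, lincomb n m i j) (mu, lincomb n m i' j') \/
   class_step (mu, lincomb n m i' j') (lam, lincomb n m i j)).
Proof.
have := count_word_d lam; have := count_word_r lam.
case/lastP wl : (word lam) => [|v []] /=; first by lia.
  rewrite -cats1 !count_cat /=.
  move=> vr vd; have [||mu [lam' [wm wl' dc]]] := @del_col_ex v; try lia.
  have <- : lam' = lam by apply: word_inj; rewrite wl wl'.
  exists mu, (i - 1), j; split; first by ring.
  right; rewrite (_ : lincomb n m i j = lincomb n m (i - 1) j + n%:Z); first by constructor.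
  by rewrite /lincomb; ring.
rewrite -cats1 !count_cat /=.
move=> vr vd; have [||lam' [mu [wl' wm dr]]] := @del_row_ex v; try lia.
have <- : lam' = lam by apply: word_inj; rewrite wl wl'.
exists mu, i, (j + 1); split; first by ring.
left; rewrite (_ : lincomb n m i (j + 1) = lincomb n m i j + m%:Z); first by constructor.
by rewrite /lincomb; ring.
Qed.

(** The difference [i - j] is the position of the window along the path; induction on its distance
    to [t] brings the window to any position. *)
Lemma window_ex lam i j t : exists mu i' j', i' - j' = t /\
  clos_refl_sym_trans _ (@class_step n m) (lam, lincomb n m i j) (mu, lincomb n m i' j').
Proof.
have step l i1 j1 mu i2 j2 :
    (class_step (l, lincomb n m i1 j1) (mu, lincomb n m i2 j2) \/
     class_step (mu, lincomb n m i2 j2) (l, lincomb n m i1 j1)) ->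
    clos_refl_sym_trans _ (@class_step n m) (l, lincomb n m i1 j1) (mu, lincomb n m i2 j2).
  by case=> H; [apply: rst_step|apply/rst_sym/rst_step].
have [s E] : exists s : nat, `|t - (i - j)%R|%N = s by exists `|t - (i - j)%R|%N.
elim: s lam i j E => [|s IH] lam i j E.
  by exists lam, i, j; split; [lia|apply: rst_refl].
have [mu [i1 [j1 [E1 /step c1]]]] : exists mu (i' j' : int), `|t - (i' - j')%R|%N = s /\
  (class_step (lam, lincomb n m i j) (mu, lincomb n m i' j') \/
   class_step (mu, lincomb n m i' j') (lam, lincomb n m i j)).
  have [lt|ge] := ltP (i - j) t.
    by have [mu [i1 [j1 [E1 c1]]]] := window_succ lam i j; exists mu, i1, j1; split=> //; lia.
  by have [mu [i1 [j1 [E1 c1]]]] := window_pred lam i j; exists mu, i1, j1; split=> //; lia.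
have [mu' [i' [j' [E' c']]]] := IH mu i1 j1 E1.
by exists mu', i', j'; split=> //; apply: rst_trans c1 c'.
Qed.

(** * Profiles *)

(* The abscissa of the down step in row [x + 1] of the periodic border whose
   window at [(i, - j)] is the border of [lam]. *)
Definition profile lam i j (x : int) : int :=
  i + ((x + j) %/ n)%Z * m%:Z + (nth 0%N (rev lam) `|((x + j) %% n)%Z|)%:Z.

Lemma profile_ge lam i j x : - j <= x -> i <= profile lam i j x.
Proof.
move=> jx; rewrite /profile.
have : 0 <= ((x + j) %/ n)%Z by rewrite divz_ge0 ?ltz_nat //; lia.
by move: (divz _ _); nia.
Qed.

Lemma profile_le lam i j x : x < - j -> profile lam i j x <= i.
Proof.
move=> xj; rewrite /profile; have := row_le lam `|((x + j) %% n)%Z|.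
have : ((x + j) %/ n)%Z < 0.
  by rewrite ltNge divz_ge0 ?ltz_nat //; lia.
by move: (divz _ _) (nth _ _ _); nia.
Qed.

(** A monotone lattice path meets each antidiagonal once, so the profile and [i - j] determine the
    start of the window; the rows of the diagram are then read off. *)
Lemma profile_inj lam mu i j i' j' : profile lam i j =1 profile mu i' j' ->
  i - j = i' - j' -> [/\ lam = mu, i = i' & j = j'].
Proof.
move=> E D.
have aux l l' i1 j1 i2 j2 : profile l i1 j1 =1 profile l' i2 j2 ->
    i1 - j1 = i2 - j2 -> i1 <= i2.
  move=> E1 D1; rewrite leNgt; apply/negP => lt.
  have := @profile_ge l i1 j1 (- j1) (lexx _); rewrite E1.
  by have := @profile_le l' i2 j2 (- j1); lia.
have ii' : i = i'.
  apply/eqP; rewrite eq_le (aux _ _ _ _ _ _ E D) /=.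
  by apply: (aux _ _ _ _ _ _ (fsym E)).
have jj' : j = j' by lia.
split=> //; apply: young_inj; apply: (@eq_from_nth _ 0%N).
  by rewrite !size_rev !size_tuple.
rewrite size_rev size_tuple => a an; have := E (a%:Z - j).
rewrite /profile -jj' -ii' subrK modz_nat modn_small //.
by move/addrI => [].
Qed.

Lemma iterz_ordS (a : 'I_n) j :
  (iterz (@ordS n) (@ord_pred n) j a : nat)%:Z = ((a%:Z + j) %% n)%Z.
Proof.
have succE (c : 'I_n) : (ordS c : nat)%:Z = ((c%:Z + 1) %% n)%Z.
  by rewrite /= -modz_nat -addn1 PoszD.
have predE (c : 'I_n) : (ord_pred c : nat)%:Z = ((c%:Z - 1) %% n)%Z.
  rewrite /= -modz_nat -[RHS](modzDr _ n%:Z); congr (modz _ _).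
  by have := ltn_ord c; lia.
case: j => p; elim: p => [|p IH].
- by rewrite /= addr0 modz_small //; have := ltn_ord a; lia.
- rewrite -[iterz _ _ _ _]/(ordS (iterz (@ordS n) (@ord_pred n) (Posz p) a)) succE IH.
  rewrite modzDml; congr (modz _ _); lia.
- exact: predE.
- rewrite -[iterz _ _ _ _]/(ord_pred (iterz (@ordS n) (@ord_pred n) (Negz p) a)) predE IH.
  rewrite modzDml; congr (modz _ _); lia.
Qed.

Lemma rotate_ex i j (b : iso_root n m) : exists a, rotate i j a = b.
Proof.
have K (T : Type) (f g : T -> T) (z : int) : cancel f g -> cancel g f ->
    cancel (iterz f g z) (iterz g f z).
  move=> fK gK; have KI p (f1 g1 : T -> T) : cancel f1 g1 -> cancel (iter p f1) (iter p g1).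
    by move=> K1; elim: p => // p IH y; rewrite iterSr /= K1 IH.
  by case: z => p; apply: KI.
exists (b.1, (iterz (@ord_pred n) (@ordS n) j b.2.1, iterz (@ordS m) (@ord_pred m) i b.2.2)).
rewrite /rotate /= !K; by [case: b => ? []|exact: ordSK|exact: ord_predK].
Qed.

(** The rotation by [j] compensates the offset of the window, so the affected rows form the residue
    class of the row of [a], whatever window is used. The new profile thus depends only on [a] and
    the old one. *)
Lemma profile_tbox (a : iso_root n m) lam mu i j x : tbox (rotate i j a) lam mu ->
  profile mu i j x =
  profile lam i j x + (-1) ^+ a.1 * (x == a.2.1%:Z %[mod n])%Z%:R.
Proof.
have H (b : iso_root n m) l l' : b.1 = false -> tbox (rotate i j b) l l' ->
    profile l' i j x = profile l i j x + (x == b.2.1%:Z %[mod n])%Z%:R.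
  move=> b1 /tbox_swap[u [v []]]; rewrite -[(rotate i j b).1]/b.1 b1 => /= wl wl' ua ub.
  set r := b.2.1 in ua *; set r' := iterz _ _ _ r in ua.
  rewrite /profile -!addrA; congr (_ + (_ + _)).
  have -> : (x == r %[mod n])%Z = (`|((x + j) %% n)%Z|%N == r').
    rewrite -(eqz_modDr j) -iterz_ordS -[iterz _ _ _ _]/r'.
    have := @modz_ge0 (x + j) n; lia.
  rewrite -!rows_word wl wl' !rows_cat /= !nth_cat !size_rows ua !add0n -[val _]/(nat_of_ord r').
  case: ltngtP => [//|lt|->]; rewrite ?addr0 //.
    by rewrite -[(_ - r')%N]prednK ?subn_gt0.
  by rewrite subnn /= -addn1 PoszD.
case: a => -[] [r c] tb /=; last by rewrite mul1r (H _ _ _ _ tb).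
move/tbox_opp: tb => tb; rewrite (H (false, (r, c)) _ _ _ tb) //= mulN1r addrK.
by [].
Qed.

(** By Bezout, steps of [n] and [m] in both directions reach every integer. *)
Lemma lincomb_ind (P : int -> Prop) : coprime n m -> P 0 ->
  (forall z, P z <-> P (z + m%:Z)) -> (forall z, P z <-> P (z + n%:Z)) ->
  forall z, P z.
Proof.
move=> co P0 Pm Pn z.
have PD (d : nat) (i : int) : (forall z', P z' <-> P (z' + d%:Z)) ->
    forall z', P z' -> P (z' + i * d%:Z).
  move=> H; case: i => p z' Pz; elim: p => [|p IH].
  - by rewrite mul0r addr0.
  - rewrite (_ : _ + _ = z' + p%:Z * d%:Z + d%:Z); last by rewrite -addn1 PoszD; ring.
    exact: (H _).1 IH.
  - by apply: (H _).2; rewrite mulN1r subrK.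
  - apply: (H _).2; rewrite (_ : _ + _ = z' + Negz p * d%:Z) //.
    by rewrite !NegzE -[p.+2]addn1 PoszD; ring.
have [i [j ->]] := lincomb_ex z co.
by apply: (PD _ _ Pm); rewrite -[i * _]add0r; apply: (PD _ _ Pn).
Qed.

(** * Local names and positive roots read off the border *)

Lemma local_roots_swap (a : iso_root n m) lam u v :
  word lam = u ++ swapped a.1 ++ v -> count is_d u = a.2.1 -> count is_r u = a.2.2 ->
  (size u < size (local_roots lam))%N /\ (local_roots lam)`_(size u) = iso_weight a.
Proof.
move=> wl ua ub; rewrite local_rootsE // size_diffs size_steps.
have uw : (size u < (size (word lam)).-1)%N.
  by rewrite wl !size_cat; case: a.1 => /=; lia.
split=> //; rewrite nth_diffs ?size_steps; last by lia.
rewrite wl steps_cat !nth_cat size_steps ltnn subnn (ltnNge _.+1) leqnSn subSnn /= ua ub.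
rewrite /iso_weight; case: a.1 => /=; rewrite !add0r ?addr0.
  by rewrite del_aff_nat // eps_aff_nat // opprB.
by rewrite del_aff_nat // eps_aff_nat.
Qed.

Lemma evec_sub_inj (a b c d : nat) : (a < N)%N -> (b < N)%N -> (c < N)%N -> (d < N)%N ->
  a != b -> c != d -> evec n m a - evec n m b = evec n m c - evec n m d ->
  a = c /\ b = d.
Proof.
move=> aN bN cN dN ab cd /(congr1 (@fst _ _)) E.
have H (x : nat) (xN : (x < N)%N) :
    (x == a)%:Z - (x == b)%:Z = (x == c)%:Z - (x == d)%:Z.
  by have /rowP/(_ (Ordinal xN)) := E; rewrite !mxE.
by have := H a aN; have := H b bN; rewrite !eqxx; lia.
Qed.

(** A difference of two distinct basis vectors determines both indices. Hence the two letters form a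
    corner at the box of [a], and exchanging them gives the required diagram. *)
Lemma local_roots_Xiso (a : iso_root n m) lam :
  iso_weight a \in local_roots lam -> Xiso a lam.
Proof.
case/(nthP 0) => p; rewrite local_rootsE // size_diffs size_steps => pw.
rewrite nth_diffs ?size_steps; last by lia.
have [u [x [y [v [wl up]]]]] : exists u x y v, word lam = u ++ [:: x, y & v] /\ size u = p.
  exists (take p (word lam)), (nth Lr (word lam) p), (nth Lr (word lam) p.+1),
    (drop p.+2 (word lam)).
  rewrite -!drop_nth ?cat_take_drop ?size_takel //; lia.
rewrite wl steps_cat -up !nth_cat size_steps ltnn subnn (ltnNge _.+1) leqnSn subSnn.
have := count_word_d lam; have := count_word_r lam; rewrite wl !count_cat => ur ud E.
have an := ltn_ord a.2.1; have bm := ltn_ord a.2.2.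
(* The indices of the labels of the two consecutive steps [x] and [y] after [u]. *)
pose s x := if is_r x then (n + count is_r u)%N else count is_d u.
pose s' x y := if is_r y then (n + (count is_r u + is_r x))%N else (count is_d u + is_d x)%N.
have {}E : evec n m (s x) - evec n m (s' x y) = iso_weight a.
  rewrite -E; move: ur ud; rewrite /s /s'; case: x {wl E}; case: y => /= ur ud;
    rewrite !add0r ?addr0 -?PoszD ?addn0.
  - by rewrite !del_aff_nat //; lia.
  - by rewrite del_aff_nat ?eps_aff_nat //; lia.
  - by rewrite del_aff_nat ?eps_aff_nat //; lia.
  - by rewrite !eps_aff_nat //; lia.
suff [xs ys ua ub] : [/\ x = nth Lr (swapped a.1) 0, y = nth Lr (swapped a.1) 1,
    count is_d u = a.2.1 & count is_r u = a.2.2].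
  have [||mu wm] := @word_ex n m (u ++ swapped (~~ a.1) ++ v).
  - by move: ud; rewrite xs ys !count_cat; case: a.1.
  - by move: ur; rewrite xs ys !count_cat; case: a.1.
  exists mu; apply/tbox_swap; exists u, v; split=> //.
  by rewrite wl xs ys; case: a.1.
have [sxN sN] : (s x < N)%N /\ (s' x y < N)%N.
  by move: ur ud; rewrite /s /s'; case: x {wl E}; case: y => /=; lia.
have ss : s x != s' x y.
  by move: ur ud; rewrite /s /s'; case: x {wl E sxN sN}; case: y => /=; lia.
move: E; rewrite /iso_weight; case: a.1.
  rewrite opprB => /evec_sub_inj[]; try lia.
  by move: ur ud; rewrite /s /s'; case: x {wl ss sxN sN}; case: y => /= ; split=> //; lia.
move=> /evec_sub_inj[]; try lia.
by move: ur ud; rewrite /s /s'; case: x {wl ss sxN sN}; case: y => /= ; split=> //; lia.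
Qed.

Lemma take_nth_cat u w x v : w = u ++ x :: v -> take (size u) w = u /\ nth Lr w (size u) = x.
Proof. by move=> ->; rewrite take_size_cat // nth_cat ltnn subnn. Qed.

Lemma border_order w u v u' v' : w = u ++ Ld :: v -> w = u' ++ Lr :: v' ->
  (size u != size u') /\ (size u < size u')%N = (count is_r u <= count is_r u')%N.
Proof.
move=> E E'; have [tu nu] := take_nth_cat E; have [tu' nu'] := take_nth_cat E'.
have uw : (size u < size w)%N by rewrite E size_cat /=; lia.
have uw' : (size u' < size w)%N by rewrite E' size_cat /=; lia.
case: (ltngtP (size u) (size u')) => [lt|lt|e]; split=> //.
- rewrite -tu -tu' -(cat_take_drop (size u) (take (size u') w)).
  by rewrite take_takel ?count_cat ?leq_addr // ltnW.
- have := @count_take_lt is_r w _ _ lt (ltnW uw); rewrite nu' tu tu' => /(_ isT).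
  by rewrite ltnNge => /negPf ->.
- by move: nu'; rewrite -e nu.
- by move: nu'; rewrite -e nu.
Qed.

(** Both steps are translated by whole periods into the window; [d] is the difference of the numbers
    of periods. If these differ they decide the inequality, since rows have length at most [m];
    otherwise [border_order] does. *)
Lemma affine_root_frame lam i j (x y : int) :
  exists p q (d : int), [/\ (p < N)%N, (q < N)%N, p != q,
    eps_aff n m x - del_aff n m y =
      (steps n m (- j) i (word lam))`_p - (steps n m (- j) i (word lam))`_q + (0, d) &
    (0 < d) || (d == 0) && (p < q)%N = (profile lam i j x <= y)].
Proof.
set a := `|((x + j) %% n)%Z|%N; set b := `|((y - i) %% m)%Z|%N.
have an : (a < n)%N by rewrite /a; lia.
have bm : (b < m)%N by rewrite /b; lia.
have [|u [v [wl ua]]] := @split_d (word lam) a; first by rewrite count_word_d.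
have [|u' [v' [wl' ub]]] := @split_r (word lam) b; first by rewrite count_word_r.
have [ne lt] := border_order wl wl'.
have xE : x = - j + a%:Z + ((x + j) %/ n)%Z * n%:Z.
  have := divz_eq (x + j) n; have := @modz_ge0 (x + j) n; rewrite /a; lia.
have yE : y = i + b%:Z + ((y - i) %/ m)%Z * m%:Z.
  have := divz_eq (y - i) m; have := @modz_ge0 (y - i) m; rewrite /b; lia.
exists (size u), (size u'), (((y - i) %/ m)%Z - ((x + j) %/ n)%Z); split=> //.
- by rewrite -(size_word lam) wl size_cat /=; lia.
- by rewrite -(size_word lam) wl' size_cat /=; lia.
- rewrite {1}wl {1}wl' !steps_cat !nth_cat !size_steps !ltnn !subnn /= ua ub.
  rewrite {1}xE {1}yE eps_affD // del_affD // opprB.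
  set q := (_ %/ _)%Z; set q' := (_ %/ _)%Z.
  rewrite (_ : (0, q' - q) = (0, q') - (0, q)); last first.
    by apply: injective_projections; rewrite //= subr0.
  by rewrite [X in _ + X = _]addrC [LHS]addrACA; congr (_ + _); apply: addrC.
- rewrite /profile -/a -rows_word wl rows_cat nth_cat size_rows ua ltnn subnn /= add0n.
  have := count_word_r lam; rewrite wl count_cat /= => um.
  rewrite lt ub [in RHS]yE.
  set q := ((x + j) %/ _)%Z; set q' := (_ %/ _)%Z.
  have [qq|qq|->] := ltgtP q q'.
   + have -> : (0 < q' - q) = true by lia.
    by apply/esym; nia.
  + have [-> ->] : (0 < q' - q) = false /\ (q' - q == 0) = false by split; lia.
    by apply/esym/negbTE; nia.
  + rewrite subrr ltxx eqxx /=; lia.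
Qed.

End Windows.

(** * Simple roots of the Borel subalgebras *)

Section Borels.
Variables (k : closedFieldType) (k_char0 : [pchar k] =i pred0) (n m : nat).
Variables (n_gt0 : (0 < n)%N) (m_gt0 : (0 < m)%N).
Variable frm : 'M[k]_(n + m) -> 'M[k]_(n + m) -> k.
Hypothesis frm_inv : @invariant_form k n m frm.
Local Notation N := (n + m)%N.
Implicit Types (lam mu : young n m) (i j : int) (u v w : seq letter).

Lemma window_base_swap s u v lam mu i j :
  word lam = u ++ swapped s ++ v -> word mu = u ++ swapped (~~ s) ++ v ->
  odd_reflection frm (size u) (window_base lam i j) = window_base mu i j.
Proof.
move=> wl wm; have := frame_steps_word n_gt0 m_gt0 (- j) i lam.
rewrite /window_base wl wm !steps_cat -(size_steps n m (- j) i u).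
by case: s {wl wm} => /=; rewrite ?addr0; apply: odd_reflection_swap.
Qed.

(** Each generating rule moves the window by one step or swaps two letters in it. *)
Lemma simple_roots_window_base lam z base : simple_roots frm lam z base ->
  exists i j, z = lincomb n m i j /\ base = window_base lam i j.
Proof.
elim=> {lam z base}.
- move=> lam; exists 0, 0; split; first by rewrite /lincomb !mul0r.
  by rewrite local_rootsE // /window_base oppr0.
- move=> lam mu _ _ _ [i [j [-> ->]]] dr; exists i, (j + 1); split.
    by rewrite /lincomb; ring.
  by have [V [z [V0 -> ->]]] := window_base_row n_gt0 m_gt0 i j dr; apply: diffs_rot.
- move=> lam mu _ _ _ [i [j [-> ->]]] /(add_col_del _ _ m_gt0) dc.
  exists (i - 1), j; split; first by rewrite /lincomb; ring.
  have [V [z [V0]]] := window_base_col n_gt0 m_gt0 (i - 1) j dc.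
  by rewrite subrK => -> ->; apply: diffs_rot.
- move=> lam mu _ _ _ [i [j [-> ->]]] /(add_row_del _ _ n_gt0) dr.
  exists i, (j - 1); split; first by rewrite /lincomb; ring.
  have [V [z [V0]]] := window_base_row n_gt0 m_gt0 i (j - 1) dr.
  by rewrite subrK => -> ->; rewrite diffs_rotr // addrK.
- move=> lam mu _ _ _ [i [j [-> ->]]] dc; exists (i + 1), j; split.
    by rewrite /lincomb; ring.
  have [V [z [V0 -> ->]]] := window_base_col n_gt0 m_gt0 i j dc.
  by rewrite diffs_rotr // addrK.
- move=> lam mu _ _ a u x y v _ [i [j [-> ->]]] tb wl wm; exists i, j; split=> //.
  (* Equal letters would give [lam = mu], but a box move changes the diagram. *)
  have xy : x <> y.
    move=> xy; have E : lam = mu by apply: word_inj; rewrite wl wm xy.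
    move: tb; rewrite E /tbox; case: a.1 => -[dx E2]; last by apply: dx; rewrite E2; right.
    by have [_] : (diagram mu `\ a.2)%classic a.2 by [rewrite -E2]; apply.
  have [s [sl sm]] : exists s, [:: x; y] = swapped s /\ [:: y; x] = swapped (~~ s).
    by case: x y xy {wl wm} => -[] // _; [exists true|exists false].
  by apply: (@window_base_swap s _ v); rewrite ?wl ?wm -?sl -?sm.
Qed.

(** The vector [loop_delta] of the root [eps_x - del_y] lies in the Borel subalgebra exactly when
    the profile at [x] is at most [y]; the profile is recovered from its upper bounds. *)
Lemma ext_borel_profile lam mu i j i' j' :
  ext_borel frm (window_base lam i j) = ext_borel frm (window_base mu i' j') ->
  profile lam i j =1 profile mu i' j'.
Proof.
move=> E x.
suff H (y : int) : (profile lam i j x <= y) = (profile mu i' j' x <= y).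
  by apply/eqP; rewrite eq_le -H lexx H lexx.
have [p [q [d [pN qN pq E1 P1]]]] := affine_root_frame n_gt0 m_gt0 lam i j x y.
have [p' [q' [d' [pN' qN' pq' E2 P2]]]] := affine_root_frame n_gt0 m_gt0 mu i' j' x y.
have fr := frame_steps_word n_gt0 m_gt0.
have [a [b [s [ab wE]]]] := frame_sub (fr (- j) i lam) pN qN pq.
have rE : eps_aff n m x - del_aff n m y = real_weight a b (s + d).
  by rewrite E1 wE; apply: injective_projections; rewrite //= addr0.
have := borel_loop_delta k_char0 frm_inv
  (ext_root (window_base lam i j) :: window_base lam i j) (s + d) ab.
have := borel_loop_delta k_char0 frm_inv
  (ext_root (window_base mu i' j') :: window_base mu i' j') (s + d) ab.
rewrite -/(ext_borel _ _) -E -/(ext_borel _ _) -rE => H1 H2.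
have F1 := frame_positive frm_inv d (fr (- j) i lam) pN qN pq.
have F2 := frame_positive frm_inv d' (fr (- j') i' mu) pN' qN' pq'.
rewrite -E1 P1 in F1; rewrite -E2 P2 in F2.
by apply/idP/idP => [/F1.2/H2.2/H1.1/F2.1|/F2.2/H1.2/H2.1/F1.1].
Qed.

Hypothesis co_nm : coprime n m.

Lemma simple_roots_uniq lam i j base : simple_roots frm lam (lincomb n m i j) base ->
  base = window_base lam i j.
Proof.
case/simple_roots_window_base=> i' [j' [E ->]].
exact: (window_base_eq n_gt0 m_gt0 _ co_nm (esym E)).
Qed.

Lemma simple_roots_tbox (a : iso_root n m) lam mu i j base u v :
  simple_roots frm lam (lincomb n m i j) base -> tbox a lam mu ->
  word lam = u ++ swapped a.1 ++ v -> word mu = u ++ swapped (~~ a.1) ++ v ->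
  simple_roots frm mu (lincomb n m i j) (odd_reflection frm (size u) base).
Proof.
move=> sr tb; move: (tb); case: a.1 => /= _ wl wm;
  exact: (simple_roots_reflection sr tb wl wm).
Qed.

(** One base at level [z] gives bases for all diagrams at that level by odd reflections, and row and
    column moves change the level by [m] and [n]. *)
Lemma simple_roots_ex lam z : exists base, simple_roots frm lam z base.
Proof.
pose Q z := forall lam, exists base, simple_roots frm lam z base.
have conn z' lam' base : simple_roots frm lam' z' base -> Q z'.
  move=> sr mu; apply: (@young_connected n m
    (fun mu => exists base, simple_roots frm mu z' base) _ lam'); last by exists base.
  move=> a l l' tb [b srb]; have [u [v [wl wl' _ _]]] := (tbox_swap a l l').1 tb.
  have [i [j [zE _]]] := simple_roots_window_base srb; rewrite zE in srb *.
  by exists (odd_reflection frm (size u) b); apply: simple_roots_tbox srb tb wl wl'.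
(* Here [l] is a single full row, and [c] below a single full column; deleting it leaves the empty
   diagram. *)
have [||l [l' [_ _ dr]]] := @del_row_ex n m n_gt0 (nseq n.-1 Ld ++ nseq m Lr).
- by rewrite count_cat !count_nseq /=; lia.
- by rewrite count_cat !count_nseq /=; lia.
have [||c [c' [_ _ dc]]] := @del_col_ex n m n_gt0 m_gt0 (nseq n Ld ++ nseq m.-1 Lr).
- by rewrite count_cat !count_nseq /=; lia.
- by rewrite count_cat !count_nseq /=; lia.
have ar := (add_row_del _ _ n_gt0).2 dr; have ac := (add_col_del _ _ m_gt0).2 dc.
have Q0 : Q 0 by move=> mu; exists (local_roots mu); constructor.
apply: (@lincomb_ind n m Q co_nm Q0 _ _ z lam) => z'; split=> Qz.
- by have [b sr] := Qz l; apply: conn (simple_roots_del_row sr dr).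
- have [b sr] := Qz l'; rewrite -[z'](addrK m%:Z).
  exact: conn (simple_roots_add_row sr ar).
- by have [b sr] := Qz c; apply: conn (simple_roots_del_col sr dc).
- have [b sr] := Qz c'; rewrite -[z'](addrK n%:Z).
  exact: conn (simple_roots_add_col sr ac).
Qed.

Lemma simple_roots_window_baseP lam i j :
  simple_roots frm lam (lincomb n m i j) (window_base lam i j).
Proof.
have [base sr] := simple_roots_ex lam (lincomb n m i j).
by rewrite -(simple_roots_uniq sr).
Qed.

Lemma ext_borel_step lam mu i j i' j' :
  class_step (lam, lincomb n m i j) (mu, lincomb n m i' j') ->
  ext_borel frm (window_base lam i j) = ext_borel frm (window_base mu i' j').
Proof.
have classP (x y : young n m * int) : class_step x y ->
    del_row x.1 y.1 /\ y.2 = x.2 + m%:Z \/ del_col x.1 y.1 /\ y.2 = x.2 + n%:Z.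
  by case=> *; [left|right].
move/classP => /= [[dr E2]|[dc E2]].
  rewrite (@window_base_eq n m n_gt0 m_gt0 mu i' j' i (j + 1)) //; last first.
    by rewrite E2 /lincomb; ring.
  have [V [z [V0 -> ->]]] := window_base_row n_gt0 m_gt0 i j dr.
  by rewrite /ext_borel; have [y [B [-> ->]]] := ext_diffs_rot z V0; rewrite borel_rot.
rewrite (@window_base_eq n m n_gt0 m_gt0 mu i' j' (i + 1) j) //; last first.
  by rewrite E2 /lincomb; ring.
have [V [z [V0 -> ->]]] := window_base_col n_gt0 m_gt0 i j dc.
by rewrite /ext_borel; have [y [B [-> ->]]] := ext_diffs_rot z V0; rewrite borel_rot.
Qed.

Lemma ext_borel_class lam mu i j i' j' :
  clos_refl_sym_trans _ (@class_step n m) (lam, lincomb n m i j) (mu, lincomb n m i' j') ->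
  ext_borel frm (window_base lam i j) = ext_borel frm (window_base mu i' j').
Proof.
pose P (x y : young n m * int) := forall i j i' j',
  x.2 = lincomb n m i j -> y.2 = lincomb n m i' j' ->
  ext_borel frm (window_base x.1 i j) = ext_borel frm (window_base y.1 i' j').
suff H x y : clos_refl_sym_trans _ (@class_step n m) x y -> P x y.
  by move/H; apply.
elim=> {x y}.
- move=> [l a] [l' b] st i1 j1 i2 j2 /= aE bE; subst a b.
  exact: ext_borel_step.
- by move=> [l a] i1 j1 i2 j2 /= -> E; rewrite (window_base_eq n_gt0 m_gt0 l co_nm E).
- by move=> x y _ IH i1 j1 i2 j2 E1 E2; rewrite (IH i2 j2 i1 j1).
- move=> x y z _ IH1 _ IH2 i1 j1 i2 j2 E1 E2.
  have [i3 [j3 E3]] := lincomb_ex y.2 co_nm.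
  by rewrite (IH1 i1 j1 i3 j3) // (IH2 i3 j3 i2 j2).
Qed.

(** The first window is moved to the position of the second within its class. This keeps the Borel
    subalgebra, hence the profile, so the windows then coincide. *)
Lemma class_profile lam mu i j i' j' : profile lam i j =1 profile mu i' j' ->
  clos_refl_sym_trans _ (@class_step n m) (lam, lincomb n m i j) (mu, lincomb n m i' j').
Proof.
move=> E.
have [l [i1 [j1 [E1 c]]]] := window_ex n_gt0 m_gt0 lam i j (i' - j').
have H := ext_borel_profile (ext_borel_class c).
have [x|lE iE jE] := @profile_inj n m n_gt0 m_gt0 l mu i1 j1 i' j' _ E1.
  by rewrite -H E.
by rewrite -lE -iE -jE.
Qed.

End Borels.

(** * Actions of the groupoid *)

Lemma iso_oppK n m : involutive (@iso_opp n m).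
Proof. by case=> s x; rewrite /iso_opp /= negbK. Qed.

Section ActionOfGraph.
Variables (n m : nat) (Y : Type).
Variables (obj : iso_root n m -> set Y) (G : iso_root n m -> Y -> Y -> Prop).
Hypothesis G_opp : forall a y z, G a y z -> G (iso_opp a) z y.
Hypothesis G_obj : forall a y z, G a y z -> obj a y.
Hypothesis G_ex : forall a y, obj a y -> exists z, G a y z.
Hypothesis G_uniq : forall a y z z', G a y z -> G a y z' -> z = z'.

Definition hom_graph (a b : iso_root n m) (g : tiso_hom a b) (y z : Y) : Prop :=
  if val g then G a y z else obj a y /\ z = y.

(** The graph of [rho a] is total and functional; bijectivity follows by applying the same to the
    opposite root, whose graph is the converse. *)
Lemma hom_graphP a b (g : tiso_hom a b) : bij_graph (obj a) (obj b) (hom_graph g).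
Proof.
have GI c y : G (iso_opp c) y =1 (fun z => G c z y).
  by move=> z; apply/propext; split=> /G_opp; rewrite ?iso_oppK.
case: g => s bE; have /eqP := bE; rewrite /hom_graph /=; case: s {bE} => ->.
  split=> [y z yz|y /G_ex[z yz]|z /G_ex[y]].
  - by split; [apply: G_obj yz|apply: (G_obj (G_opp yz))].
  - by exists z; split=> // z'; apply: G_uniq.
  - rewrite GI => yz; exists y; split=> // y' yz'.
    by apply: (@G_uniq (iso_opp a) z); rewrite GI.
split=> [y z [ay ->]//|y ay|y ay]; exists y; split=> // z; first by case.
by case.
Qed.

Definition hom_sbij a b (g : tiso_hom a b) : sbij (obj a) (obj b) :=
  SBij (hom_graphP g).

Lemma hom_sbij_id a : hom_sbij (tiso_id a) = sbij_id (obj a).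
Proof. exact: sbij_inj. Qed.

Lemma hom_sbij_comp a b c (g : tiso_hom b c) (f : tiso_hom a b) :
  hom_sbij (tiso_comp g f) = sbij_comp (hom_sbij g) (hom_sbij f).
Proof.
apply: sbij_inj => x z; case: g f => s cE [t bE]; have /eqP bE' := bE.
rewrite /= /hom_graph /= {cE}; case: t {bE} bE' => ->; case: s => /=.
- split=> [[ax ->]|[y xy yz]].
    by have [y xy] := G_ex ax; exists y => //; apply: G_opp.
  by split; [apply: G_obj xy|apply: (G_uniq yz (G_opp xy))].
- split=> [xz|[y xy [_ ->]]//]; exists z => //; split=> //.
  exact: (G_obj (G_opp xz)).
- split=> [xz|[y [_ ->]]//]; exists x => //; split=> //.
  exact: G_obj xz.
- split=> [[ax ->]|[y [ax ->] [_ ->]]]; last by [].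
  by exists x.
Qed.

Definition graph_action : action (tiso n m) Y :=
  @GFunctor (tiso n m) (subset_groupoid Y) obj hom_sbij hom_sbij_id hom_sbij_comp.

End ActionOfGraph.

(** * Classes and the equivariant bijection *)

Lemma mkclassP n m (lam mu : young n m) (y z : int) :
  mkclass lam y = mkclass mu z <->
  clos_refl_sym_trans _ (@class_step n m) (lam, y) (mu, z).
Proof.
split=> [/(congr1 sval)/= E|H].
  have : class_set (mu, z) (mu, z) by apply: rst_refl.
  by rewrite -E.
apply/eq_exist => /=; apply/seteqP; split=> x /=; last exact: rst_trans.
by apply: rst_trans; apply: rst_sym.
Qed.

Theorem theorem1p1 (k : closedFieldType) (k_char0 : [pchar k] =i pred0)
    (n m : nat) (n_gt0 : (0 < n)%N) (m_gt0 : (0 < m)%N) (co_nm : coprime n m)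
    (frm : 'M[k]_(n + m) -> 'M[k]_(n + m) -> k)
    (frm_inv : @invariant_form k n m frm) :
  exists (F : action (tiso n m) (classes n m))
         (B : action (tiso n m) (@borels k n m frm)),
    [/\ is_actionF F, is_actionB B &
        exists w : classes n m -> @borels k n m frm,
          equivariant F B w /\
          sval (w (mkclass (young0 n m) 0)) =
            ext_borel frm (local_roots (young0 n m))].
Proof.
have class_eq (lam mu : young n m) i j i' j' :
    profile lam i j =1 profile mu i' j' <->
    mkclass lam (lincomb n m i j) = mkclass mu (lincomb n m i' j').
  split=> [E|/mkclassP E]; first apply/mkclassP.
    exact: (class_profile k_char0 n_gt0 m_gt0 frm_inv co_nm E).
  apply: (ext_borel_profile k_char0 n_gt0 m_gt0 frm_inv).
  exact: ext_borel_class E.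
have borel_eq (lam mu : young n m) i j i' j' :
    mkclass lam (lincomb n m i j) = mkclass mu (lincomb n m i' j') <->
    ext_borel frm (window_base lam i j) = ext_borel frm (window_base mu i' j').
  split=> [/mkclassP|E]; first exact: ext_borel_class.
  by apply/class_eq; apply: ext_borel_profile E.
have classP (y : classes n m) : exists (lam : young n m) i j,
    y = mkclass lam (lincomb n m i j).
  case: y => C H; case: (H) => -[lam z] E.
  have [i [j zE]] := lincomb_ex z co_nm; exists lam, i, j.
  by apply/eq_exist; rewrite E zE.
pose G (a : iso_root n m) (y z : classes n m) := exists lam mu i j,
  [/\ tbox (rotate i j a) lam mu, y = mkclass lam (lincomb n m i j) &
      z = mkclass mu (lincomb n m i j)].
pose obj (a : iso_root n m) : set (classes n m) := fun y =>
  exists lam i j, Xiso (rotate i j a) lam /\ y = mkclass lam (lincomb n m i j).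
have G_opp a y z : G a y z -> G (iso_opp a) z y.
  case=> lam [mu [i [j [tb yE zE]]]]; exists mu, lam, i, j; split=> //.
  by apply/(tbox_opp (rotate i j a)).
have G_obj a y z : G a y z -> obj a y.
  by case=> lam [mu [i [j [tb yE zE]]]]; exists lam, i, j; split=> //; exists mu.
have G_ex a y : obj a y -> exists z, G a y z.
  case=> lam [i [j [[mu tb] yE]]]; exists (mkclass mu (lincomb n m i j)).
  by exists lam, mu, i, j.
(* Representatives of the same class have the same profile, and by [profile_tbox] the box move
   changes it in the same way for both. *)
have G_uniq a y z z' : G a y z -> G a y z' -> z = z'.
  case=> lam [mu [i [j [tb -> ->]]]] [lam' [mu' [i' [j' [tb' yE ->]]]]].
  apply/class_eq => x; rewrite (profile_tbox n_gt0 m_gt0 x tb) (profile_tbox n_gt0 m_gt0 x tb').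
  by have /class_eq -> := yE.
(* Quantifying over all representatives of [y] includes the independence of their choice in the
   specification. *)
pose w_spec y (b : borels frm) := forall lam i j, y = mkclass lam (lincomb n m i j) ->
  sval b = ext_borel frm (window_base lam i j).
have w_ex y : exists b, w_spec y b.
  have [lam [i [j yE]]] := classP y.
  have H : exists lam' z base, simple_roots frm lam' z base /\
      ext_borel frm (window_base lam i j) = ext_borel frm base.
    exists lam, (lincomb n m i j), (window_base lam i j); split=> //.
    exact: simple_roots_window_baseP.
  exists (exist _ (ext_borel frm (window_base lam i j)) H) => lam' i' j' /=.
  by rewrite yE => /borel_eq.
pose w y := sval (cid (w_ex y)).
have wP (lam : young n m) i j :
    sval (w (mkclass lam (lincomb n m i j))) = ext_borel frm (window_base lam i j).
  exact: (svalP (cid (w_ex (mkclass lam (lincomb n m i j))))).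
have w_eq y (b : borels frm) : sval b = sval (w y) -> b = w y.
  by case: b (w y) => X HX [X1 HX1] /= E; apply: eq_exist.
have w_inj : injective w.
  move=> y z; have [lam [i [j ->]]] := classP y; have [mu [i' [j' ->]]] := classP z.
  by move/(congr1 sval); rewrite !wP => /borel_eq.
have w_surj b : exists y, b = w y.
  case: (svalP b) => lam [z [base [sr bE]]].
  have [i [j [zE baseE]]] := simple_roots_window_base k_char0 n_gt0 m_gt0 frm_inv sr.
  by exists (mkclass lam (lincomb n m i j)); apply: w_eq; rewrite wP bE baseE.
(* The second action is the transport of the first along [w], so equivariance is built in; it is
   identified with odd reflections when [is_actionB] is proved. *)
pose objB a (b : borels frm) := exists y, obj a y /\ b = w y.
pose GB a (b b' : borels frm) := exists y z, [/\ G a y z, b = w y & b' = w z].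
have GB_opp a b b' : GB a b b' -> GB (iso_opp a) b' b.
  by case=> y [z [/G_opp yz -> ->]]; exists z, y.
have GB_obj a b b' : GB a b b' -> objB a b.
  by case=> y [z [/G_obj ay -> _]]; exists y.
have GB_ex a b : objB a b -> exists b', GB a b b'.
  by case=> y [/G_ex[z yz] ->]; exists (w z), y, z.
have GB_uniq a b b' b'' : GB a b b' -> GB a b b'' -> b' = b''.
  case=> y [z [yz -> ->]] [y' [z' [yz' /w_inj yy' ->]]].
  by rewrite -yy' in yz'; congr w; apply: G_uniq yz yz'.
have local_root (a : iso_root n m) lam mu : tbox a lam mu -> exists u v,
    [/\ word lam = u ++ swapped a.1 ++ v, word mu = u ++ swapped (~~ a.1) ++ v,
       (size u < size (local_roots lam))%N & (local_roots lam)`_(size u) = iso_weight a].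
  case/tbox_swap => u [v [wl wm ua ub]].
  by have [us uE] := local_roots_swap n_gt0 m_gt0 wl ua ub; exists u, v.
pose F := graph_action G_opp G_obj G_ex G_uniq.
pose B := graph_action GB_opp GB_obj GB_ex GB_uniq.
have srP := simple_roots_window_baseP k_char0 n_gt0 m_gt0 frm_inv co_nm.
have srU := simple_roots_uniq k_char0 n_gt0 m_gt0 frm_inv co_nm.
exists F, B; split.
- by [].
- split=> a b.
    split=> [[y [[lam [i [j [[mu tb] ->]]]] ->]]|[lam [i [j [base [sr ra bE]]]]]].
      exists lam, i, j, (window_base lam i j); split; rewrite ?wP //.
      by have [u [v [_ _ us <-]]] := local_root _ _ _ tb; apply: mem_nth.
    exists (mkclass lam (lincomb n m i j)); split.
      by exists lam, i, j; split=> //; apply: (local_roots_Xiso n_gt0 m_gt0) ra.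
    by apply: w_eq; rewrite wP bE (srU _ _ _ _ sr).
  move=> b'; split.
    case=> y [z [[lam [mu [i [j [tb -> ->]]]]] -> ->]].
    have [u [v [wl wm us uE]]] := local_root _ _ _ tb.
    exists lam, mu, i, j, (window_base lam i j), (size u).
    rewrite (window_base_swap k_char0 n_gt0 m_gt0 frm_inv i j wl wm) !wP.
    by split.
  case=> lam [mu [i [j [base [p [sr _ bE bE' [tb sr']]]]]]].
  exists (mkclass lam (lincomb n m i j)), (mkclass mu (lincomb n m i j)); split.
  + by exists lam, mu, i, j.
  + by apply: w_eq; rewrite wP bE (srU _ _ _ _ sr).
  + by apply: w_eq; rewrite wP bE' (srU _ _ _ _ sr').
exists w; split; last first.
  have E : 0 = lincomb n m 0 0 by rewrite /lincomb !mul0r.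
  by rewrite [X in mkclass _ X]E wP local_rootsE // /window_base oppr0.
have Fmor a b (g : @ghom (tiso n m) a b) y z :
    act_mor F g y z <-> act_mor B g (w y) (w z).
  rewrite /act_mor /= /hom_graph; case: (val g).
    split=> [yz|[y' [z' [yz /w_inj -> /w_inj ->]]]//].
    by exists y, z.
  split=> [[ay ->]|[[y' [ay /w_inj ->]] /w_inj ->]//].
  by split=> //; exists y.
have Ftrans : act_transitive F.
  exists (mkclass (young0 n m) 0) => y.
  pose R := clos_refl_sym_trans _ (act_edge F).
  have R_trans x1 x2 x3 : R x1 x2 -> R x2 x3 -> R x1 x3 by apply: rst_trans.
  have R_sym x1 x2 : R x1 x2 -> R x2 x1 by apply: rst_sym.
  (* At a fixed level, box moves connect all diagrams; [rotate_ex] turns the local root of each move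
     into a root of the groupoid. *)
  have connected z (lam mu : young n m) : R (mkclass lam z) (mkclass mu z).
    have [i [j ->]] := lincomb_ex z co_nm.
    apply: (@young_connected n m
      (fun mu => R (mkclass lam (lincomb n m i j)) (mkclass mu (lincomb n m i j)))
      _ lam mu); last exact: rst_refl.
    move=> c l l' tb; have [a aE] := rotate_ex i j c.
    move=> H; apply: R_trans H _; apply: rst_step.
    exists a, (iso_opp a), (rho a); rewrite -aE in tb.
    by exists l, l', i, j.
  pose P z := R (mkclass (young0 n m) 0) (mkclass (young0 n m) z).
  have P_step z z' (l l' : young n m) : mkclass l z = mkclass l' z' -> P z <-> P z'.
    move=> E; have H : R (mkclass (young0 n m) z) (mkclass (young0 n m) z').
      by apply: (R_trans _ (mkclass l z)); [|rewrite E]; apply: connected.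
    by split=> Pz; [apply: R_trans Pz H|apply: R_trans Pz (R_sym _ _ H)].
  (* Different levels are linked because the class of a full row or column at level [z] is that of
     the empty diagram at level [z + m] or [z + n]. *)
  have Pall z : P z.
    apply: (lincomb_ind co_nm) z; first exact: rst_refl.
      have [||l [l' [_ _ dr]]] := @del_row_ex n m n_gt0 (nseq n.-1 Ld ++ nseq m Lr).
      - by rewrite count_cat !count_nseq /=; lia.
      - by rewrite count_cat !count_nseq /=; lia.
      move=> z; apply: (P_step _ _ l l'); apply/mkclassP/rst_step; exact: class_step_r.
    have [||l [l' [_ _ dc]]] := @del_col_ex n m n_gt0 m_gt0 (nseq n Ld ++ nseq m.-1 Lr).
    - by rewrite count_cat !count_nseq /=; lia.
    - by rewrite count_cat !count_nseq /=; lia.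
    move=> z; apply: (P_step _ _ l l'); apply/mkclassP/rst_step; exact: class_step_c.
  have [lam [i [j ->]]] := classP y.
  exact: R_trans (Pall _) (connected _ _ _).
split=> //.
- have [y0 Fy0] := Ftrans; exists (w y0) => b; have [z ->] := w_surj b.
  elim: (Fy0 z) => [y z' [a [c [g yz]]]|y|y z' _ IH|x y z' _ IH1 _ IH2].
  + by apply: rst_step; exists a, c, g; apply/Fmor.
  + exact: rst_refl.
  + exact: rst_sym.
  + exact: rst_trans IH1 IH2.
- have w_surj' b : {y | b = w y} by apply: cid.
  exists (fun b => sval (w_surj' b)) => [y|b]; last by rewrite -(svalP (w_surj' b)).
  by apply: w_inj; rewrite -(svalP (w_surj' (w y))).
- move=> a; apply/seteqP; split=> b /=.
    by case=> y [ay ->]; exists y.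
  by case=> y ay <-; exists y.
Qed.
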